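(* Consider the risk process $R(t)=u+ct-S(t)$, $t\ge0$, with initial capital $u\ge0$, premium income rate $c>0$ and $$S(t)=I\{N(t)>0\}\sum_{i=1}^{N(t)}\sum_{s=1}^d I\{U_{is}>0\}\sum_{j=1}^{U_{is}}\tilde Y_{ijs},$$ where $N$, $U_{is}$, $\tilde Y_{ijs}$ are as described in the context, and suppose $\mathbb{E}\tilde Y_{11s}<\infty$ and $\mathbb{E}\tilde U_{1s}<\infty$ for $s=1,\dots,d$. Then $R$ is a particular case of the Cramer-Lundberg risk process with initial capital $u$ and premium income rate $c$. Moreover: (a) The intensity of the corresponding homogeneous Poisson claim counting process is $$\lambda=(\tilde\lambda_1+\dots+\tilde\lambda_d)(1-p_0)=\sum_{s=1}^d[1-\mathbb{P}(\tilde U_{1s}=0)]\tilde\lambda_s.$$ (b) The total claim amount within the $i$-th group (the $i$-th claim of the Cramer-Lundberg model), $i=1,2,\dots$, is $$Y_i\stackrel{d}{=}I\{U_{i1}>0\}\sum_{j=1}^{U_{i1}}\tilde Y_{ij1}+\dots+I\{U_{id}>0\}\sum_{j=1}^{U_{id}}\tilde Y_{ijd}.$$ These random variables are strictly positive, i.i.d., with common non-lattice c.d.f., and their mean is $$\mathbb{E}(Y_1)=\sum_{s=1}^d\frac{\tilde\lambda_s\mathbb{E}\tilde U_{1s}}{(\tilde\lambda_1+\dots+\tilde\lambda_d)(1-p_0)}\mathbb{E}\tilde Y_{11s}<\infty.$$ If the coordinates of $(\tilde Y_{111},\dots,\tilde Y_{11d})$ are independent, then, for every real $z$ for which the quantities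 on the right are finite, $$\mathbb{E}(e^{zY_1})=\sum_{s=1}^d\frac{\tilde\lambda_s\big[g_{\tilde U_{1s}}(\mathbb{E}e^{z\tilde Y_{11s}})-\mathbb{P}(\tilde U_{1s}=0)\big]}{(\tilde\lambda_1+\dots+\tilde\lambda_d)(1-p_0)};$$ if in addition $\mathbb{D}\tilde Y_{11s}<\infty$ and $\mathbb{D}\tilde U_{1s}<\infty$ for $s=1,\dots,d$, then $$\mathbb{D}(Y_1)=\sum_{s=1}^d\frac{\tilde\lambda_s\{\mathbb{D}\tilde U_{1s}[\mathbb{E}\tilde Y_{11s}]^2+(\mathbb{E}\tilde U_{1s})^2[\mathbb{E}\tilde Y_{11s}]^2+\mathbb{E}\tilde U_{1s}\mathbb{D}\tilde Y_{11s}\}}{(\tilde\lambda_1+\dots+\tilde\lambda_d)(1-p_0)}-\Big\{\sum_{s=1}^d\frac{\tilde\lambda_s\mathbb{E}\tilde U_{1s}\,\mathbb{E}\tilde Y_{11s}}{(\tilde\lambda_1+\dots+\tilde\lambda_d)(1-p_0)}\Big\}^2,$$ which in the case $d=1$ reads $$\mathbb{D}(Y_1)=\frac{\mathbb{D}\tilde U_{11}[\mathbb{E}\tilde Y_{111}]^2+\mathbb{E}\tilde U_{11}\mathbb{D}\tilde Y_{111}}{1-p_0}-\frac{p_0(\mathbb{E}\tilde U_{11})^2(\mathbb{E}\tilde Y_{111})^2}{(1-p_0)^2}.$$ Let $F_s$ be the c.d.f. of $\tilde Y_{11s}$, and let $\tilde L_s\ge0$ and $\tilde R_s\le\infty$ be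 the lower and upper end points of the distribution of $\tilde U_{1s}$. Then for $x\ge0$, $$F_{Y_1}(x)=\sum_{s=1}^d\sum_{j=\tilde L_s}^{\tilde R_s}F_s^{j*}(x)\frac{\tilde\lambda_s\mathbb{P}(\tilde U_{1s}=j)}{(\tilde\lambda_1+\dots+\tilde\lambda_d)(1-p_0)}-\frac{p_0}{1-p_0},$$ $$1-F_{Y_1}(x)=\sum_{s=1}^d\sum_{j=\tilde L_s}^{\tilde R_s}[1-F_s^{j*}(x)]\frac{\tilde\lambda_s\mathbb{P}(\tilde U_{1s}=j)}{(\tilde\lambda_1+\dots+\tilde\lambda_d)(1-p_0)}.$$ If the coordinates of $(\tilde Y_{111},\dots,\tilde Y_{11d})$ are independent, then for $z>0$ $$l_{Y_1}(z)=g_{U_{11},\dots,U_{1d}}(l_{\tilde Y_{111}}(z),\dots,l_{\tilde Y_{11d}}(z))=\frac{\sum_{s=1}^d\frac{\tilde\lambda_s}{\tilde\lambda_1+\dots+\tilde\lambda_d}g_{\tilde U_{1s}}(l_{\tilde Y_{11s}}(z))-p_0}{1-p_0}$$ and $$l_{F_{I,Y_1}}(z)=\frac{\sum_{s=1}^d\tilde\lambda_s[1-g_{\tilde U_{1s}}(l_{\tilde Y_{11s}}(z))]}{z\sum_{s=1}^d\tilde\lambda_s\mathbb{E}\tilde U_{1s}\mathbb{E}\tilde Y_{11s}}.$$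
   Context: Model. Let $d\in\mathbb{N}$ (number of claim types) and $\tilde\lambda_1,\dots,\tilde\lambda_d>0$. Groups of claims of type $s$ arrive according to independent homogeneous Poisson processes $\tilde N_s$ with intensities $\tilde\lambda_s$. The vectors $\overrightarrow{\tilde U}_i=(\tilde U_{i1},\dots,\tilde U_{id})$, $i\ge1$, are i.i.d. with independent non-negative integer-valued coordinates ($\tilde U_{is}$ is the number of type-$s$ claims). For each $i$, $A_{i1},\dots,A_{id}$ is a partition of the sample space with $\mathbb{P}(A_{is})=\tilde\lambda_s/(\tilde\lambda_1+\dots+\tilde\lambda_d)$, independent for different $i$ and independent of the $\overrightarrow{\tilde U}_i$'s. Put $$p_0=\frac{\sum_{s=1}^d\mathbb{P}(\tilde U_{1s}=0)\tilde\lambda_s}{\tilde\lambda_1+\dots+\tilde\lambda_d},$$ assumed $<1$. The vectors $\overrightarrow U_i=(U_{i1},\dots,U_{id})$, $i\ge1$, are i.i.d., distributed as $(I\{A_{11}\}\tilde U_{11},\dots,I\{A_{1d}\}\tilde U_{1d})$ conditioned on this vector being different from $(0,\dots,0)$. $N$ is a homogeneous Poisson process with intensity $(\tilde\lambda_1+\dots+\tilde\lambda_d)(1-p_0)$ (it counts the non-empty groups), independent of the $\overrightarrow U_i$'s. The claim size vectors $(\tilde Y_{ij1},\dots,\tilde Y_{ijd})$, $i,j\ge1$, are i.i.d., independent of $N$ and of the $\overrightarrow U_i$'s; each coordinate $\tilde Y_{ijs}$ (size of the $j$-th type-$s$ claim in group $i$) is a.s. positive with non-lattice distribution. Cramer-Lundberg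 risk process with initial capital $u$ and premium rate $c$: $R(t)=u+ct-I\{N(t)>0\}\sum_{i=1}^{N(t)}Y_i$, where $N$ is a homogeneous Poisson process and, independently of $N$, the $Y_i$ are i.i.d. positive random variables with non-lattice c.d.f. and finite mean. Notation. $\mathbb{D}X$ is the variance; $I\{\cdot\}$ the indicator; $g_X(z)=\mathbb{E}z^X$ and $g_{X_1,\dots,X_d}(z_1,\dots,z_d)=\mathbb{E}[z_1^{X_1}\cdots z_d^{X_d}]$ are probability generating functions; $l_X(z)=\mathbb{E}e^{-zX}$ is the Laplace–Stieltjes transform of $X$, and for a c.d.f. $F$ on $[0,\infty)$, $l_F(z)=\int_{[0,\infty)}e^{-zx}dF(x)$. $F^{j*}$ is the $j$-fold convolution of $F$, with $F^{0*}(x)=I\{x\ge0\}$. $F_{I,Y_1}(x)=\frac1{\mathbb{E}Y_1}\int_0^x(1-F_{Y_1}(y))dy$ is the integrated tail c.d.f. of $Y_1$. *)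

(* Defs.v *)
From HB Require Import structures.
From mathcomp Require Import all_boot all_order all_algebra.
From mathcomp Require Import all_classical all_reals all_analysis.

Set Implicit Arguments.
Unset Strict Implicit.
Unset Printing Implicit Defensive.

Import Order.TTheory GRing.Theory Num.Theory.
Import numFieldNormedType.Exports.

Local Open Scope classical_set_scope.
Local Open Scope ring_scope.

Section probability_notions.
Context {disp : measure_display} {T : measurableType disp} {R : realType}.
Variable P : probability T R.

Definition mutually_independent {I : eqType} (F : I -> set (set T)) : Prop :=
  forall (J : seq I) (E : I -> set T),
    uniq J -> (forall i, i \in J -> F i (E i)) ->
    P (\bigcap_(i in [set` J]) E i) = (\prod_(i <- J) P (E i))%E.

Definition independent2 (F G : set (set T)) : Prop :=
  forall A B, F A -> G B -> P (A `&` B) = (P A * P B)%E.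

Definition sigma_family {I : Type} {disp' : measure_display}
    {T' : measurableType disp'} (D : set I) (X : I -> T -> T') : set (set T) :=
  <<s \bigcup_(i in D) g_sigma_algebra_preimage (X i) >>.

Definition iid {I : eqType} {disp' : measure_display}
    {T' : measurableType disp'} (X : I -> T -> T') : Prop :=
  mutually_independent (fun i => g_sigma_algebra_preimage (X i)) /\
  (forall i j (B : set T'), measurable B -> P (X i @^-1` B) = P (X j @^-1` B)).

Definition cond_prob (E F : set T) : \bar R :=
  (fine (P (E `&` F)) / fine (P F))%:E.

(* Concentrated on a (possibly shifted) lattice a + hZ; in particular an a.s.
   constant variable is lattice. *)
Definition lattice (X : T -> R) : Prop :=
  exists a h : R, 0 < h /\ P [set w | exists k : int, X w = a + k%:~R * h] = 1%E.

Definition pgf (X : T -> nat) (z : R) : \bar R := 'E_P[fun w => z ^+ X w].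

Definition joint_pgf {n : nat} (X : 'I_n -> T -> nat) (z : 'I_n -> R) : \bar R :=
  'E_P[fun w => \prod_(s < n) z s ^+ X s w].

Definition laplace (X : T -> R) (z : R) : \bar R :=
  'E_P[fun w => expR (- (z * X w))].

Definition mean (X : T -> R) : R := fine 'E_P[X].

Definition var (X : T -> R) : R := fine 'V_P[X].

Definition natrv (X : T -> nat) : T -> R := fun w => (X w)%:R.

Definition pr_eq (X : T -> nat) (k : nat) : R := fine (P [set w | X w = k]).

Definition lower_end (X : T -> nat) : \bar R :=
  ereal_inf [set (k%:R)%:E | k in [set k | 0 < pr_eq X k]].

Definition upper_end (X : T -> nat) : \bar R :=
  ereal_sup [set (k%:R)%:E | k in [set k | 0 < pr_eq X k]].

(* F^{j*}, F being the c.d.f. of X: F^{(j+1)*}(x) is the Lebesgue-Stieltjes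
   integral of F^{j*}(x - y) dF(y), i.e. the integral with respect to the law
   of X. *)
Fixpoint conv_pow (X : {RV P >-> R}) (j : nat) (x : R) : \bar R :=
  if j is j'.+1 then (\int[distribution P X]_y conv_pow X j' (x - y))%E
  else if 0 <= x then 1%E else 0%E.

Definition integrated_tail (X : {RV P >-> R}) (x : R) : R :=
  (mean X)^-1 *
  fine (\int[lebesgue_measure]_(y in `[0%R, x]) (1 - cdf X y))%E.

(* Only the times t >= 0 of N matter. *)
Record poisson_process (lam : R) (N : R -> {RV P >-> nat}) : Prop := {
  pp_intensity : 0 < lam ;
  pp_start : {ae P, forall w, N 0 w = 0%N} ;
  pp_paths : {ae P, forall w,
    (forall s t, 0 <= s -> s <= t -> (N s w <= N t w)%N) /\
    (forall t, 0 <= t -> \forall s \near t^'+, N s w = N t w)} ;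
  pp_independent : forall t : nat -> R,
    0 <= t 0%N -> nondecreasing_seq t ->
    mutually_independent (fun k =>
      g_sigma_algebra_preimage (fun w => (N (t k.+1) w - N (t k) w)%N)) ;
  pp_poisson : forall s t k, 0 <= s -> s < t ->
    P [set w | (N t w - N s w)%N = k] = (poisson_pmf (lam * (t - s)) k)%:E }.

Definition sigma_process (N : R -> {RV P >-> nat}) : set (set T) :=
  sigma_family [set t : R | 0 <= t] (fun t => N t : T -> nat).

End probability_notions.

(* I{n > 0} (x_1 + ... + x_n), with x indexed from 0. *)
Definition random_sum {R : realType} (n : nat) (x : nat -> R) : R :=
  if (0 < n)%N then \sum_(i < n) x i else 0.

(* Laplace-Stieltjes transform of a c.d.f. F *)
Definition lst_cdf {R : realType} (F : cumulativeBounded (0 : R) (1 : R))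
    (z : R) : \bar R :=
  (\int[lebesgue_stieltjes_measure F]_(x in `[0%R, +oo[)
     (expR (- (z * x)))%:E)%E.

Definition vec {T V : Type} {n : nat} (X : 'I_n -> T -> V) (w : T) :
  n.-tuple V := [tuple X s w | s < n].

Section cramer_lundberg.
Context {disp : measure_display} {T : measurableType disp} {R : realType}.
Variable P : probability T R.

(* Y i is the (i+1)-st claim. *)
Record cramer_lundberg (u c lam : R) (N : R -> {RV P >-> nat})
    (Y : nat -> {RV P >-> R}) (risk : R -> T -> R) : Prop := {
  cl_poisson : poisson_process lam N ;
  cl_iid : iid P (fun i => Y i : T -> R) ;
  cl_positive : forall i, {ae P, forall w, 0 < Y i w} ;
  cl_nonlattice : forall i, ~ lattice P (Y i) ;
  cl_mean : forall i, ('E_P[Y i] < +oo)%E ;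
  cl_independent : independent2 P (sigma_process N)
    (sigma_family setT (fun i => Y i : T -> R)) ;
  cl_risk : forall t w, 0 <= t ->
    risk t w = u + c * t - random_sum (N t w) (fun i => Y i w) }.

End cramer_lundberg.

Section group_claim.
Context {disp : measure_display} {T : measurableType disp} {R : realType}.
Variables (P : probability T R) (d : nat).
Variables (U : 'I_d -> {RV P >-> nat}) (Y : nat -> 'I_d -> {RV P >-> R}).

Definition group_claim (w : T) : R :=
  \sum_(s < d) random_sum (U s w) (fun j => Y j s w).

Lemma measurable_group_claim : measurable_fun setT group_claim.
Proof.
apply: measurable_sum => s _ B mB; rewrite setTI.
have -> : (fun w => random_sum (U s w) (fun j => Y j s w)) @^-1` B =
  \bigcup_n ((U s @^-1` [set n]) `&`
             ((fun w => random_sum n (fun j => Y j s w)) @^-1` B)).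
  apply/seteqP; split=> [w Bw|w [n _ [/= <-]]//].
  by exists (U s w).
apply: bigcup_measurable => n _; apply: measurableI.
  exact: measurable_funPTI.
rewrite -[X in measurable X]setTI.
have mf : measurable_fun setT (fun w => random_sum n (fun j => Y j s w)).
  rewrite /random_sum; case: (0 < n)%N; last exact: measurable_cst.
  by apply: measurable_sum.
exact: mf.
Qed.

HB.instance Definition _ :=
  isMeasurableFun.Build _ _ _ _ group_claim measurable_group_claim.

End group_claim.

Section group_model.
Context {disp : measure_display} {T : measurableType disp} {R : realType}.
Variables (P : probability T R) (d : nat).

Definition empty_group_prob (rate : 'I_d -> R)
    (Utilde : nat -> 'I_d -> {RV P >-> nat}) : R :=
  (\sum_(s < d) pr_eq P (Utilde 0%N s) 0%N * rate s) / \sum_(s < d) rate s.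

(* All indices are shifted by one: group 0 and claim 0 here are the first group
   and the first claim. The vectors are given by their coordinates;
   [Aset i s] is the event that the (i+1)-st group is of type s. *)
Record group_claims_model := {
  rate : 'I_d -> R ;
  Ntilde : 'I_d -> R -> {RV P >-> nat} ;
  Utilde : nat -> 'I_d -> {RV P >-> nat} ;
  Aset : nat -> 'I_d -> set T ;
  Uvec : nat -> 'I_d -> {RV P >-> nat} ;
  Ncount : R -> {RV P >-> nat} ;
  Ytilde : nat -> nat -> 'I_d -> {RV P >-> R} ;

  rate_gt0 : forall s, 0 < rate s ;
  Ntilde_poisson : forall s, poisson_process (rate s) (Ntilde s) ;
  Ntilde_independent : mutually_independent P (fun s => sigma_process (Ntilde s)) ;

  Utilde_iid : iid P (fun i => vec (Utilde i : 'I_d -> T -> nat)) ;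
  Utilde_coordinates : forall i,
    mutually_independent P (fun s => g_sigma_algebra_preimage (Utilde i s)) ;

  Aset_measurable : forall i s, measurable (Aset i s) ;
  Aset_disjoint : forall i, trivIset setT (Aset i) ;
  Aset_cover : forall i, \bigcup_s Aset i s = setT ;
  Aset_prob : forall i s, P (Aset i s) = (rate s / \sum_(r < d) rate r)%:E ;
  Aset_independent : mutually_independent P (fun i => <<s range (Aset i) >>) ;
  Aset_independent_Utilde : independent2 P
    <<s \bigcup_i range (Aset i) >>
    (sigma_family setT (fun i => vec (Utilde i : 'I_d -> T -> nat))) ;

  empty_group_prob_lt1 : empty_group_prob rate Utilde < 1 ;

  Uvec_iid : iid P (fun i => vec (Uvec i : 'I_d -> T -> nat)) ;
  Uvec_law : let V s w := ((w \in Aset 0%N s) * Utilde 0%N s w)%N in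
    forall i (B : set (d.-tuple nat)), measurable B ->
    P (vec (Uvec i : 'I_d -> T -> nat) @^-1` B) =
    cond_prob P (vec V @^-1` B) [set w | vec V w != [tuple 0%N | s < d]] ;

  Ncount_poisson : poisson_process
    ((\sum_(s < d) rate s) * (1 - empty_group_prob rate Utilde)) Ncount ;
  Ncount_independent_U : independent2 P (sigma_process Ncount)
    (sigma_family setT (fun i => vec (Uvec i : 'I_d -> T -> nat))) ;

  Ytilde_iid : iid P (fun ij : nat * nat =>
    vec (Ytilde ij.1 ij.2 : 'I_d -> T -> R)) ;
  Ytilde_independent : independent2 P
    (sigma_family setT (fun ij : nat * nat =>
      vec (Ytilde ij.1 ij.2 : 'I_d -> T -> R)))
    <<s sigma_process Ncount `|`
        sigma_family setT (fun i => vec (Uvec i : 'I_d -> T -> nat)) >> ;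
  Ytilde_positive : forall i j s, {ae P, forall w, 0 < Ytilde i j s w} ;
  Ytilde_nonlattice : forall i j s, ~ lattice P (Ytilde i j s) }.

Variable M : group_claims_model.

Definition total_rate : R := \sum_(s < d) rate M s.

Definition p0 : R := empty_group_prob (rate M) (Utilde M).

Definition Utilde1 (s : 'I_d) : {RV P >-> nat} := Utilde M 0%N s.

Definition Ytilde11 (s : 'I_d) : {RV P >-> R} := Ytilde M 0%N 0%N s.

Definition claim (i : nat) : {RV P >-> R} := group_claim (Uvec M i) (Ytilde M i).

Definition total_claim_amount (t : R) (w : T) : R :=
  random_sum (Ncount M t w) (fun i =>
    \sum_(s < d) random_sum (Uvec M i s w) (fun j => Ytilde M i j s w)).

Definition risk_process (u c t : R) (w : T) : R :=
  u + c * t - total_claim_amount t w.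

End group_model.

(* Main.v *)
(* Idea. Thinning: the vector (I{A_1} U~_1, ..., I{A_d} U~_d) has at most one
   nonzero coordinate, so conditioning on it being nonzero gives, for every
   f >= 0,
     (1 - p0) E f(Y_1) + p0 f(0)
       = sum_s (rate_s / total_rate) E[h_s(U~_s)],
   where h_s(k) = E f(S_{s,k}) and S_{s,k} is the sum of k independent claims of
   type s.  Every formula of the theorem is this identity for one f: |x|, x^2,
   exp(z x), an indicator.  The indicator of x <= 0 gives
   strict positivity; the indicator of {x > 0} minus a lattice gives the
   non-lattice property, since if S_{s,k} lived on a lattice, then freezing all
   summands but one would put a single claim on a shifted lattice.  Independence
   between groups is inherited from the mutual independence of N, the U_i and
   the Y_ij by grouping sigma-algebras.  The integrated tail c.d.f. is the c.d.f.
   of the normalized marginal of Lebesgue x P restricted to {0 <= y < Y_1}, and both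
   transforms of that law follow from Tonelli's theorem. *)

Require Import Defs.
From HB Require Import structures.
From mathcomp Require Import all_boot all_order all_algebra.
From mathcomp Require Import all_classical all_reals all_analysis.
From mathcomp Require Import measurable_realfun.
From mathcomp Require Import ring.

Set Implicit Arguments.
Unset Strict Implicit.
Unset Printing Implicit Defensive.

Import Order.TTheory GRing.Theory Num.Theory.
Import numFieldNormedType.Exports.

Local Open Scope classical_set_scope.
Local Open Scope ring_scope.

(** * Independence of generated sigma-algebras *)

(** The identity keeps [1 - p0] as a factor and adds the term at 0 instead of dividing and
    subtracting. In this form it holds between extended reals for every nonnegative [f], and
    finiteness is asked only of the right side, when the identity is solved for the integral over
    the claim. Because [f] must be nonnegative everywhere while claims are positive only almost
    surely, the mean is computed from the absolute value. The law of a claim is reached in two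
    stages. The composition vector takes countably many values, so it is frozen first, which leaves
    a function of the composition alone; thinning is then applied to that function. The model gives
    independence in separate pieces. They are assembled into one mutually independent family of
    sources, and each independence needed later amounts to a map sending every source to its block.
    The integrated tail has to be exhibited as a bundled c.d.f. Realizing it as the c.d.f. of a
    probability measure yields monotonicity, right continuity and both limits without further
    work. *)

Lemma bigcap_seqE (I : eqType) (U : Type) (s : seq I) (E : I -> set U) :
  \bigcap_(i in [set` s]) E i = \big[setI/setT]_(i <- s) E i.
Proof.
elim: s => [|i s IHs]; first by rewrite big_nil set_nil bigcap_set0.
rewrite big_cons -IHs; apply/seteqP; split=> [x Ex|x [Eix Ex] j /=].
  split; first by apply: Ex; rewrite /= mem_head.
  by move=> j js; apply: Ex; rewrite /= inE js orbT.
by rewrite inE => /predU1P[->//|]; exact: Ex.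
Qed.

Lemma big_sum_seq (S : Type) (idx : S) (op : Monoid.com_law idx)
    (I J : Type) (s : seq (I + J)) (F : I + J -> S) :
  \big[op/idx]_(k <- s) F k =
  op (\big[op/idx]_(i <- pmap (fun k => if k is inl i then Some i else None) s)
        F (inl i))
     (\big[op/idx]_(j <- pmap (fun k => if k is inr j then Some j else None) s)
        F (inr j)).
Proof.
elim: s => [|[i|j] s IHs] /=; first by rewrite !big_nil Monoid.mulm1.
  by rewrite !big_cons IHs Monoid.mulmA.
by rewrite !big_cons IHs Monoid.mulmCA.
Qed.

Section independence.
Context {disp : measure_display} {T : measurableType disp} {R : realType}.
Variable P : probability T R.

Lemma sub_sigma_sigma (F G : set (set T)) : F `<=` <<s G >> -> <<s F >> `<=` <<s G >>.
Proof. by move=> FG; apply: smallest_sub => //; exact: smallest_sigma_algebra. Qed.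

Lemma sub_g_sigma_measurable (G : set (set T)) :
  G `<=` measurable -> <<s G >> `<=` measurable.
Proof.
move=> Gm; apply: smallest_sub => //.
by split=> [//|A mA|B mB]; [rewrite setTD; exact: measurableC|
  exact: bigcupT_measurable].
Qed.

(** The measurable sets obeying the product rule against the fixed [C] form a Dynkin system, and [G]
    is a pi-system. *)
Lemma product_rule_sigma (G : set (set T)) (C : set T) :
  setI_closed G -> G `<=` measurable -> measurable C ->
  (forall A, G A -> P (A `&` C) = (P A * P C)%E) ->
  forall A, <<s G >> A -> P (A `&` C) = (P A * P C)%E.
Proof.
move=> GI Gm mC PG A.
rewrite -setI_closed_g_dynkin_g_sigma_algebra// => sA.
(* Measurability is carried through the induction because the complement and union steps use it. *)
suff [] : measurable A /\ P (A `&` C) = (P A * P C)%E by [].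
move: A sA; apply: smallest_sub; last by move=> A GA; split; [exact: Gm|exact: PG].
split=> [|A [mA PA]|F tF mF].
- by split=> //; rewrite setTI probability_setT mul1e.
- split; first exact: measurableC.
  have -> : P (~` A `&` C) = (P C - P A * P C)%E.
    rewrite -PA setIC -setDE (setIC A); apply: measureD => //.
    by rewrite ltey_eq fin_num_measure.
  have -> : P (~` A) = (1 - P A)%E by exact: probability_setC.
  by rewrite muleBl ?mul1e//; exact: fin_num_measure.
- have mFn n : measurable (F n) by have [] := mF n.
  split; first exact: bigcupT_measurable.
  have mFC n : measurable (F n `&` C) by exact: measurableI.
  rewrite setI_bigcupl.
  have -> : P (\bigcup_i F i) = (\sum_(0 <= i <oo) P (F i))%E.
    by apply: measure_semi_bigcup => //; exact: bigcupT_measurable.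
  have -> : P (\bigcup_i (F i `&` C)) = (\sum_(0 <= i <oo) P (F i `&` C))%E.
    apply: measure_semi_bigcup => //; last exact: bigcupT_measurable.
    exact: trivIset_setIr.
  rewrite muleC -[P C]fineK ?fin_num_measure// -nneseriesZl//.
  apply: eq_eseriesr => n _; have [_ ->] := mF n.
  by rewrite muleC fineK// fin_num_measure.
Qed.

Lemma mutually_independent_sub (I : eqType) (F G : I -> set (set T)) :
  (forall i, F i `<=` G i) -> mutually_independent P G ->
  mutually_independent P F.
Proof. by move=> FG indG J E uJ FE; apply: indG => // i /FE; exact: FG. Qed.

(* The indices pass one at a time from the pi-systems [F i] to the sigma-algebras
   they generate. *)
Lemma mutually_independent_sigma (I : eqType) (F : I -> set (set T)) :
  (forall i, setI_closed (F i)) -> (forall i, F i `<=` measurable) ->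
  mutually_independent P F -> mutually_independent P (fun i => <<s F i >>).
Proof.
move=> FI Fm indF.
have sFm i := sub_g_sigma_measurable (Fm i).
(* [J1] lists the indices already promoted to the generated sigma-algebras, [J2] those still
   confined to the pi-systems. *)
suff H (J1 J2 : seq I) (E : I -> set T) : uniq (J1 ++ J2) ->
    (forall i, i \in J1 -> <<s F i >> (E i)) ->
    (forall i, i \in J2 -> F i (E i)) ->
    P (\bigcap_(i in [set` J1 ++ J2]) E i) = (\prod_(i <- J1 ++ J2) P (E i))%E.
  by move=> J E uJ FE; rewrite -(cats0 J); apply: H => //; rewrite cats0.
elim: J1 J2 E => [|j J1 IH] J2 E /=; first by move=> *; exact: indF.
case/andP => jJ uJ sE FE.
have E_eq (A : set T) : {in J1 ++ J2, forall i, (if i == j then A else E i) = E i}.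
  by move=> i iJ; case: eqP => // ij; rewrite -ij iJ in jJ.
have pJ : perm_eq (J1 ++ j :: J2) (j :: J1 ++ J2).
  by apply/permPl => ?; rewrite -(perm_catCA J1 [:: j] J2).
set C := \bigcap_(i in [set` J1 ++ J2]) E i.
have mC : measurable C.
  rewrite /C bigcap_seqE big_seq; apply: big_ind => //.
    exact: measurableI.
  move=> i; rewrite mem_cat => /orP[iJ|iJ]; last exact: (Fm i _ (FE i iJ)).
  by apply: (sFm i); apply: sE; rewrite inE iJ orbT.
have PC : P C = (\prod_(i <- J1 ++ J2) P (E i))%E.
  by apply: IH => // i iJ; apply: sE; rewrite inE iJ orbT.
rewrite bigcap_seqE !big_cons -bigcap_seqE -/C -PC.
apply: (product_rule_sigma (FI j) (Fm j) mC); last first.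
  by apply: sE; rewrite mem_head.
move=> A FA.
(* With [A] in place of [E j], the index [j] may be moved to the pi-system list, where the induction
   hypothesis applies. *)
pose E' i := if i == j then A else E i.
have CE : C = \bigcap_(i in [set` J1 ++ J2]) E' i.
  by apply: eq_bigcapr => i iJ; rewrite /E' E_eq.
have -> : A `&` C = \bigcap_(i in [set` J1 ++ j :: J2]) E' i.
  rewrite CE !bigcap_seqE (perm_big _ pJ) /=.
  by rewrite big_cons {2}/E' eqxx.
rewrite IH.
- rewrite (perm_big _ pJ) /=.
  rewrite big_cons {1}/E' eqxx PC; congr (_ * _)%E.
  by apply: eq_big_seq => i iJ; rewrite /E' E_eq.
- by rewrite (perm_uniq pJ) /= jJ.
- move=> i iJ; rewrite /E' E_eq ?mem_cat ?iJ//; apply: sE.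
  by rewrite inE iJ orbT.
- move=> i; rewrite inE => /predU1P[->|iJ]; first by rewrite /E' eqxx.
  by rewrite /E' E_eq ?mem_cat ?iJ ?orbT//; exact: FE.
Qed.

(** The fibres of [phi] are the blocks; functions of distinct blocks are then independent, and the
    independence statements about the claims follow by choosing [phi]. *)
Lemma mutually_independent_group (K I : eqType) (phi : K -> I)
    (G : K -> set (set T)) :
  (forall k, setI_closed (G k)) -> (forall k, G k setT) ->
  (forall k, G k `<=` measurable) ->
  mutually_independent P G ->
  mutually_independent P
    (fun i => <<s \bigcup_(k in [set k | phi k = i]) G k >>).
Proof.
move=> GI GT Gm indG.
(* The finite intersections of sets from one group form a pi-system that generates
   the sigma-algebra of the group. *)
pose cyl i := [set A | exists (L : seq K) (E : K -> set T),
  [/\ forall k, k \in L -> phi k = i, forall k, G k (E k) &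
   A = \bigcap_(k in [set` L]) E k]].
apply: (@mutually_independent_sub _ _ (fun i => <<s cyl i >>)).
  move=> i; apply: sub_smallest2r; first exact: smallest_sigma_algebra.
  move=> A [k /= ki GA]; exists [:: k], (fun k' => if k' == k then A else setT).
  split=> [j|k'|].
  - by rewrite inE => /eqP ->.
  - by case: eqP => [->//|_]; exact: GT.
  - by rewrite bigcap_seqE big_seq1 eqxx.
apply: mutually_independent_sigma.
- move=> i _ _ [L1 [E1 [L1i GE1 ->]]] [L2 [E2 [L2i GE2 ->]]].
  pose E k := (if k \in L1 then E1 k else setT) `&`
              (if k \in L2 then E2 k else setT).
  exists (L1 ++ L2), E; split.
  + by move=> k; rewrite mem_cat => /orP[/L1i|/L2i].
  + by move=> k; apply: GI; case: ifP.
  + apply/seteqP; split=> [x [E1x E2x] k /=|x Ex].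
      by move=> _; split; case: ifPn => // ?; [exact: E1x|exact: E2x].
    split=> k /= kL; have := Ex k; rewrite /= mem_cat kL ?orbT => /(_ isT).
      by case; rewrite kL.
    by case=> _; rewrite kL.
- move=> i _ [L [E [Li GE ->]]]; rewrite bigcap_seqE; apply: big_ind => //.
    exact: measurableI.
  by move=> k _; exact: Gm.
move=> J A uJ cylA.
have /choice[LE LEP] : forall i, exists LE : seq K * (K -> set T), i \in J ->
    [/\ forall k, k \in LE.1 -> phi k = i, forall k, G k (LE.2 k) &
   A i = \bigcap_(k in [set` LE.1]) LE.2 k].
  move=> i; have [iJ|iJ] := boolP (i \in J); last by exists ([::], fun=> setT).
  by have [L [E H]] := cylA _ iJ; exists (L, E).
(* The intersection of cylinders is flattened to one intersection over the concatenated list [LL].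
   Since [phi] tells which group an index belongs to, the lists of distinct groups are disjoint and
   one function [E] serves them all. *)
pose L i := undup (LE i).1; pose E k := (LE (phi k)).2 k.
pose LL := [seq k | i <- J, k <- L i].
have AE i : i \in J -> A i = \big[setI/setT]_(k <- L i) E k.
  move=> iJ; have [Li _ ->] := LEP _ iJ.
  rewrite -bigcap_seqE; apply/seteqP; split=> x Ex k /=.
    by rewrite mem_undup => kL; rewrite /E Li//; exact: Ex.
  move=> kL; have := Ex k; rewrite /= mem_undup kL => /(_ isT).
  by rewrite /E Li.
have LLP k : k \in LL -> phi k \in J.
  move=> /allpairsPdep[i [k' [iJ kL ->]]]; have [Li _ _] := LEP _ iJ.
  by rewrite Li// -mem_undup.
have uLL : uniq LL.
  apply: allpairs_uniq_dep => // [i _|]; first exact: undup_uniq.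
  move=> _ _ /allpairsPdep[i [k [iJ kL ->]]] /allpairsPdep[i' [k' [iJ' kL' ->]]].
  rewrite /= => kk'; rewrite -kk' in kL' *.
  have [Li _ _] := LEP _ iJ; have [Li' _ _] := LEP _ iJ'.
  by rewrite -(Li k) ?(Li' k)// -mem_undup.
have PE (L' : seq K) : uniq L' -> {subset L' <= LL} ->
    P (\big[setI/setT]_(k <- L') E k) = (\prod_(k <- L') P (E k))%E.
  move=> uL' sL; rewrite -bigcap_seqE; apply: indG => // k /sL /LLP kJ.
  by have [_ GE _] := LEP _ kJ; exact: GE.
transitivity (P (\big[setI/setT]_(k <- LL) E k)).
  rewrite bigcap_seqE big_allpairs_dep; congr (P _).
  by apply: eq_big_seq => i iJ; rewrite AE.
rewrite PE// big_allpairs_dep; apply: eq_big_seq => i iJ.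
rewrite AE// PE ?undup_uniq// => k kL; apply/allpairsPdep.
by exists i, k.
Qed.

(** A duplicate-free list over [unit] has at most one entry. This lets the single sigma-algebra of
    the counting process enter [mutually_independent_sum] as a family. *)
Lemma mutually_independent_unit (F : unit -> set (set T)) :
  mutually_independent P F.
Proof.
move=> [|[] [|[] J]] E //= _ _.
  by rewrite bigcap_seqE !big_nil probability_setT.
by rewrite bigcap_seqE !big_seq1.
Qed.

(** A list over [I + J] splits into its two sides, and the intersection over each side lies in the
    sigma-algebra generated by that side's family, where [independent2] applies. *)
Lemma mutually_independent_sum (I J : eqType)
    (F : I -> set (set T)) (G : J -> set (set T)) :
  mutually_independent P F -> mutually_independent P G ->
  independent2 P <<s \bigcup_i F i >> <<s \bigcup_j G j >> ->
  mutually_independent P (fun k => match k with inl i => F i | inr j => G j end).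
Proof.
move=> indF indG indFG L E uL FGE.
rewrite bigcap_seqE !big_sum_seq /=.
set L1 := pmap _ L; set L2 := pmap _ L.
have L1L i : i \in L1 -> inl i \in L.
  by rewrite mem_pmap => /mapP[[j|j]// jL [->]].
have L2L i : i \in L2 -> inr i \in L.
  by rewrite mem_pmap => /mapP[[j|j]// jL [->]].
have sI (H : set (set T)) (S : eqType) (s : seq S) (A : S -> set T) :
    (forall i, i \in s -> H (A i)) -> <<s H >> (\big[setI/setT]_(i <- s) A i).
  move=> HA.
  have [HT _ _ HI] := (sigma_algebraP (fun X _ => @subsetT T X)).1
    (smallest_sigma_algebra setT H).
  rewrite big_seq; apply: big_ind => //.
  by move=> i /HA; exact: sub_sigma_algebra.
have FE i : i \in L1 -> F i (E (inl i)) by move=> /L1L /FGE.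
have GE j : j \in L2 -> G j (E (inr j)) by move=> /L2L /FGE.
rewrite indFG; last 2 first.
- by apply: sI => i iL; exists i => //; exact: FE.
- by apply: sI => j jL; exists j => //; exact: GE.
have uL1 : uniq L1 by apply: (pmap_uniq (g := inl)) uL; case.
have uL2 : uniq L2 by apply: (pmap_uniq (g := inr)) uL; case.
by rewrite -!bigcap_seqE indF// indG.
Qed.

End independence.

(** * Integrals of independent random variables *)

Section product_rule_integrals.
Context {disp : measure_display} {T : measurableType disp} {R : realType}.
Variable P : probability T R.
Context {d1 d2 : measure_display}.
Context {T1 : measurableType d1} {T2 : measurableType d2}.
Local Open Scope ereal_scope.

(** The law of the pair and the product of the laws agree on rectangles, hence everywhere; Tonelli's
    theorem then integrates [X] with [Y] frozen. *)
Lemma integral_independent2 (X : {RV P >-> T1}) (Y : {RV P >-> T2})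
    (f : T1 * T2 -> \bar R) :
  independent2 P (g_sigma_algebra_preimage X) (g_sigma_algebra_preimage Y) ->
  measurable_fun setT f -> (forall x, 0 <= f x) ->
  \int[P]_w f (X w, Y w) =
  \int[distribution P Y]_y \int[P]_w f (X w, y).
Proof.
move=> indXY mf f0.
have mXY : measurable_fun setT (fun w => (X w, Y w)).
  exact: measurable_fun_pair.
pose XYm := isMeasurableFun.Build _ _ _ _ _ mXY.
pose XY : {mfun T >-> (T1 * T2)%type} := HB.pack (fun w => (X w, Y w)) XYm.
have XYE A : measurable A ->
    (distribution P X \x distribution P Y) A = distribution P XY A.
  apply: product_measure_unique => {}A B mA mB.
  rewrite /distribution /pushforward /=.
  rewrite -[RHS]indXY; last 2 first.
  - by exists A => //; rewrite setTI.
  - by exists B => //; rewrite setTI.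
  by congr (P _).
transitivity (\int[distribution P XY]_z f z).
  by rewrite ge0_integral_distribution.
transitivity (\int[distribution P X \x distribution P Y]_z f z).
  by apply: eq_measure_integral => A mA _; exact/esym/XYE.
rewrite fubini_tonelli1// fubini_tonelli//; apply: eq_integral => y _.
rewrite /fubini_G ge0_integral_distribution//.
exact: measurableT_comp.
Qed.

Lemma integral_mul_independent2 (X : {RV P >-> T1}) (Y : {RV P >-> T2})
    (f : T1 -> \bar R) (g : T2 -> \bar R) :
  independent2 P (g_sigma_algebra_preimage X) (g_sigma_algebra_preimage Y) ->
  measurable_fun setT f -> (forall x, 0 <= f x) ->
  measurable_fun setT g -> (forall y, 0 <= g y) ->
  \int[P]_w (f (X w) * g (Y w)) = \int[P]_w f (X w) * \int[P]_w g (Y w).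
Proof.
move=> indXY mf f0 mg g0.
rewrite (integral_independent2 (f := fun z => f z.1 * g z.2) indXY); last 2 first.
- by apply: emeasurable_funM; apply: measurableT_comp.
- by move=> z; rewrite mule_ge0.
rewrite -(@ge0_integral_distribution _ _ _ _ _ P Y g)// -ge0_integralZl//; last first.
  exact: integral_ge0.
apply: eq_integral => y _ /=; rewrite ge0_integralZr//.
exact: measurableT_comp.
Qed.

End product_rule_integrals.

(** * Integrals over events and countable partitions *)

Section restricted_integrals.
Context {disp : measure_display} {T : measurableType disp} {R : realType}.
Variable P : probability T R.
Local Open Scope ereal_scope.

Lemma integral_restrict_independent {d1 : measure_display}
    {T1 : measurableType d1} (A : set T) (X : {RV P >-> T1})
    (f : T1 -> \bar R) :
  measurable A ->
  (forall B, measurable B -> P (A `&` X @^-1` B) = P A * P (X @^-1` B)) ->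
  measurable_fun setT f -> (forall x, 0 <= f x) ->
  \int[P]_(w in A) f (X w) = P A * \int[P]_w f (X w).
Proof.
move=> mA indA mf f0.
pose I : {RV P >-> R} := indic_mfun A mA.
have indXI : independent2 P (g_sigma_algebra_preimage X) (g_sigma_algebra_preimage I).
  move=> _ _ [B mB <-] [C mC <-]; rewrite !setTI preimage_indic setIC.
  have mXB : measurable (X @^-1` B) by exact: measurable_funPTI.
  case: ifP => _; case: ifP => _.
  - by rewrite setTI probability_setT mule1.
  - by rewrite indA// muleC.
  (* The preimages under an indicator are the whole space, [A], its complement and the empty set;
     for the complement the rule extends from the pi-system made of [A] alone. *)
  - have /= := @product_rule_sigma _ _ _ P [set A] (X @^-1` B).
    rewrite muleC; apply => //.
    + by move=> _ _ -> ->; rewrite setIid.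
    + by move=> _ ->.
    + by move=> _ ->; exact: indA.
    + have [_ + _] := smallest_sigma_algebra setT [set A].
      by rewrite -setTD; apply; exact: sub_sigma_algebra.
  - by rewrite set0I !measure0 mule0.
rewrite integral_mkcond epatch_indic.
(* The absolute value makes the second factor a function nonnegative on all of [R], as
   [integral_mul_independent2] asks. *)
transitivity (\int[P]_w (f (X w) * `|I w|%:E)).
  by apply: eq_integral => w _ /=; rewrite ger0_norm// indicE.
rewrite (integral_mul_independent2 (g := fun y : R => `|y|%:E) indXI)//; last first.
  by apply/measurable_EFinP; exact: normr_measurable.
rewrite muleC; congr (_ * _).
transitivity (\int[P]_w (\1_A w)%:E).
  by apply: eq_integral => w _ /=; rewrite ger0_norm// indicE.
by rewrite integral_indic// setIT.
Qed.

Lemma integral_cst_probability (x : \bar R) : \int[P]_w cst x w = x.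
Proof.
rewrite integral_cst// [X in _ * X](_ : _ = 1) ?mule1//.
exact: probability_setT.
Qed.

(** Meant for [V] the composition vector of a group: the integrand may be replaced separately on
    each event of a given composition. *)
Lemma integral_countable_partition (I : countType) (V : T -> I)
    (f g : T -> \bar R) :
  (forall i, measurable [set w | V w = i]) ->
  measurable_fun setT f -> (forall w, 0 <= f w) ->
  measurable_fun setT g -> (forall w, 0 <= g w) ->
  (forall i, \int[P]_(w in [set w | V w = i]) f w =
             \int[P]_(w in [set w | V w = i]) g w) ->
  \int[P]_w f w = \int[P]_w g w.
Proof.
move=> mV mf f0 mg g0 fg.
(* Numbering the values by [pickle] indexes the fibres by [nat]; codes that are not attained give
   empty sets. *)
pose F n := [set w | pickle (V w) = n].
have FT : \bigcup_n F n = setT.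
  by apply/seteqP; split=> // w _; exists (pickle (V w)).
have tF : trivIset setT F.
  apply/trivIsetP => i j _ _ ij; rewrite -subset0 => w [/= iw jw].
  by rewrite -iw -jw eqxx in ij.
have FE n : F n = set0 \/ exists i, F n = [set w | V w = i].
  have [[w Fw]|FN] := pselect (F n !=set0); last first.
    by left; rewrite -subset0 => w Fw; apply: FN; exists w.
  right; exists (V w); apply/seteqP; split=> x /=; rewrite /F /= -?Fw.
    exact: (pcan_inj pickleK).
  by move=> ->.
have mF n : measurable (F n).
  by case: (FE n) => [->|[i ->]].
rewrite -FT !ge0_integral_bigcup// ?FT//.
apply: eq_eseriesr => n _; case: (FE n) => [->|[i ->]//].
by rewrite !integral_set0.
Qed.

Lemma integral_nat_rv (U : {RV P >-> nat}) (h : nat -> \bar R) :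
  (forall k, 0 <= h k) ->
  \int[P]_w h (U w) = \sum_(0 <= k <oo) h k * (pr_eq P U k)%:E.
Proof.
move=> h0.
have mU k : measurable (U @^-1` [set k]) by exact: measurable_funPTI.
have UT : \bigcup_k (U @^-1` [set k]) = setT.
  by apply/seteqP; split=> // w _; exists (U w).
have mhU : measurable_fun setT (fun w => h (U w)).
  by apply: (@measurableT_comp _ _ _ _ _ _ h).
rewrite -UT ge0_integral_bigcup ?UT//; last exact: trivIset_preimage1.
apply: eq_eseriesr => k _.
rewrite (eq_integral (cst (h k))); last by move=> w; rewrite inE /= => ->.
rewrite integral_cst// /pr_eq fineK//; exact/fin_num_measure/mU.
Qed.

End restricted_integrals.

(** * Sigma-algebras generated by random variables *)

Section generated_sigma_algebras.
Context {disp : measure_display} {T : measurableType disp} {R : realType}.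
Variable P : probability T R.

(** Turns an inclusion of sigma-algebras into measurability on [g_sigma_algebraType G], so that the
    closure rules for measurable functions can prove it. *)
Lemma g_sigma_algebra_preimageP {d : measure_display} {T' : measurableType d}
    (G : set (set T)) (f : T -> T') :
  g_sigma_algebra_preimage f `<=` <<s G >> <->
  measurable_fun [set: g_sigma_algebraType G] (f : g_sigma_algebraType G -> T').
Proof.
split=> [fG _ B mB|mf _ [B mB <-]]; first by apply: fG; exists B.
exact: mf.
Qed.

Lemma sub_sigma_family {I : Type} {d : measure_display} {T' : measurableType d}
    (D : set I) (X : I -> T -> T') i :
  D i -> g_sigma_algebra_preimage (X i) `<=` sigma_family D X.
Proof. by move=> Di A XA; apply: sub_sigma_algebra; exists i. Qed.

Lemma independent2_sub (F G F' G' : set (set T)) :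
  F' `<=` F -> G' `<=` G -> independent2 P F G -> independent2 P F' G'.
Proof. by move=> FF GG indFG A B /FF FA /GG; exact: indFG. Qed.

Lemma mutually_independent_pair (I : eqType) (F : I -> set (set T)) i j :
  i != j -> mutually_independent P F -> independent2 P (F i) (F j).
Proof.
move=> ij indF A B FA FB.
have := indF [:: i; j] (fun k => if k == i then A else B).
rewrite bigcap_seqE !big_cons !big_nil eqxx eq_sym (negbTE ij) setIT mule1.
apply; first by rewrite /= inE ij.
by move=> k; rewrite !inE => /orP[] /eqP ->; rewrite ?eqxx// eq_sym (negbTE ij).
Qed.

Lemma g_sigma_algebra_preimage_measurable {d : measure_display}
    {T' : measurableType d} (X : {RV P >-> T'}) :
  g_sigma_algebra_preimage X `<=` measurable.
Proof. by move=> _ [B mB <-]; rewrite setTI; exact: measurable_funPTI. Qed.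

Lemma sigma_family_measurable {I : Type} {d' : measure_display}
    {T' : measurableType d'} (D : set I) (X : I -> {RV P >-> T'}) :
  sigma_family D (fun i => X i : T -> T') `<=` measurable.
Proof.
apply: sub_g_sigma_measurable => A [i _].
exact: g_sigma_algebra_preimage_measurable.
Qed.

Lemma g_sigma_algebra_preimageT {d : measure_display}
    {T' : measurableType d} (X : T -> T') : g_sigma_algebra_preimage X setT.
Proof. by exists setT => //; rewrite setTI preimage_setT. Qed.

Lemma g_sigma_algebra_preimageI {d : measure_display}
    {T' : measurableType d} (X : T -> T') :
  setI_closed (g_sigma_algebra_preimage X).
Proof.
move=> _ _ [A mA <-] [B mB <-]; exists (A `&` B); first exact: measurableI.
by rewrite !setTI preimage_setI.
Qed.

Lemma integral_indic_preimage {d : measure_display} {T' : measurableType d}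
    (Z : {RV P >-> T'}) (A : set T') : measurable A ->
  (\int[P]_w (\1_A (Z w))%:E)%E = P (Z @^-1` A).
Proof.
move=> mA; have mZA : measurable (Z @^-1` A) by exact: measurable_funPTI.
by rewrite -[in RHS](setIT (Z @^-1` A)) -integral_indic.
Qed.

Lemma probability_setC0 (A : set T) : measurable A ->
  P (~` A) = 0%E <-> P A = 1%E.
Proof.
move=> mA; have -> : P (~` A) = (1 - P A)%E by exact: probability_setC.
split=> [/eqP|->]; last by rewrite subee.
by rewrite sube_eq ?add0e// ?fin_num_measure// => /eqP ->.
Qed.

End generated_sigma_algebras.

Lemma measurable_lattice (R : realType) (a h : R) :
  measurable [set x : R | exists k : int, x = a + k%:~R * h].
Proof.
apply: countable_measurable => //.
rewrite (_ : [set x | _] = range (fun k : int => a + k%:~R * h)); last first.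
  by apply/seteqP; split=> [x [n ->]|_ [n _ <-]]; [exists n|exists n].
exact: sub_countable (card_image_le _ _) _.
Qed.

(** * Partial sums of i.i.d. variables *)

Section partial_sums.
Context {disp : measure_display} {T : measurableType disp} {R : realType}.
Variables (P : probability T R) (Y : nat -> {RV P >-> R}).

Definition psum (k : nat) (w : T) : R := \sum_(j < k) Y j w.

Lemma measurable_psum k : measurable_fun setT (psum k).
Proof. by apply: measurable_sum => j; exact: measurable_funPT. Qed.

HB.instance Definition _ k :=
  isMeasurableFun.Build _ _ _ _ (psum k) (measurable_psum k).

Lemma psum0 w : psum 0 w = 0. Proof. by rewrite /psum big_ord0. Qed.

Lemma psumS k w : psum k.+1 w = psum k w + Y k w.
Proof. by rewrite /psum big_ord_recr. Qed.

Hypothesis iidY : iid P (fun j => Y j : T -> R).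

(** Two blocks: the indices below [k], which determine [psum k], and the remaining ones, among them
    [k]. *)
Lemma independent2_psum k :
  independent2 P (g_sigma_algebra_preimage (psum k)) (g_sigma_algebra_preimage (Y k)).
Proof.
have := @mutually_independent_group _ _ _ P _ _ (fun j => (j < k)%N) _
  (fun j => @g_sigma_algebra_preimageI _ T _ _ (Y j))
  (fun j => @g_sigma_algebra_preimageT _ T _ _ (Y j))
  (fun j => @g_sigma_algebra_preimage_measurable _ T R P _ _ (Y j)) iidY.1.
move=> /(mutually_independent_pair (i := true) (j := false) isT).
apply: independent2_sub.
  apply/g_sigma_algebra_preimageP; apply: measurable_sum => j.
  apply/g_sigma_algebra_preimageP => A YA; apply: sub_sigma_algebra.
  by exists (nat_of_ord j) => //=; rewrite ltn_ord.
by move=> A YA; apply: sub_sigma_algebra; exists k => //=; rewrite ltnn.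
Qed.

Local Open Scope ereal_scope.

Lemma integral_distribution_iid j (f : R -> \bar R) :
  \int[distribution P (Y j)]_y f y = \int[distribution P (Y 0%N)]_y f y.
Proof. by apply: eq_measure_integral => A mA _; exact: iidY.2. Qed.

(** The convolution recursion, with the order of integration used in [conv_pow]. *)
Lemma integral_psumS k (f : R -> \bar R) :
  measurable_fun setT f -> (forall x, 0 <= f x) ->
  \int[P]_w f (psum k.+1 w) =
  \int[distribution P (Y 0%N)]_y \int[P]_w f (psum k w + y)%R.
Proof.
move=> mf f0; rewrite -(integral_distribution_iid k).
rewrite -(integral_independent2 (f := fun z : R * R => f (z.1 + z.2)%R)
  (@independent2_psum k)).
- by apply: eq_integral => w _; rewrite psumS.
- by apply: measurableT_comp => //; exact: measurable_funD.
- by move=> z.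
Qed.

Lemma integral_iid j (f : R -> \bar R) :
  measurable_fun setT f -> (forall x, 0 <= f x) ->
  \int[P]_w f (Y j w) = \int[P]_w f (Y 0%N w).
Proof.
move=> mf f0; rewrite -(@ge0_integral_distribution _ _ _ _ _ P (Y j) f)//.
rewrite -(@ge0_integral_distribution _ _ _ _ _ P (Y 0%N) f)//.
exact: integral_distribution_iid.
Qed.

Lemma conv_pow_psum k x : conv_pow (Y 0%N) k x = P [set w | (psum k w <= x)%R].
Proof.
elim: k x => [|k IH] x.
  rewrite /=; under [in RHS]eq_fun do rewrite psum0.
  by case: leP => x0; rewrite ?set_true ?set_false ?probability_setT ?measure0.
pose f (u : R) := (\1_[set u : R | (u <= x)%R] u)%:E : \bar R.
have mx (y : R) : measurable [set u : R | (u <= y)%R].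
  by rewrite [X in measurable X](_ : _ = `]-oo, y]%classic)//;
     apply/seteqP; split=> u /=; rewrite in_itv.
have mf : measurable_fun setT f.
  by apply/measurable_EFinP; exact: measurable_indic.
have fE (Z : {RV P >-> R}) (y : R) :
   \int[P]_w f (Z w + y)%R = P [set w | (Z w <= x - y)%R].
  rewrite -[RHS]/(P (Z @^-1` [set u : R | (u <= x - y)%R])).
  rewrite -integral_indic_preimage//.
  apply: eq_integral => w _; rewrite /f !indicE; congr (nat_of_bool _)%:R%:E.
  by apply/idP/idP; rewrite !inE /= lerBrDr.
transitivity (\int[P]_w f (psum k.+1 w)); last first.
  by rewrite -[x in RHS]subr0 -fE; under [RHS]eq_integral do rewrite addr0.
rewrite integral_psumS//=; last by move=> u; rewrite lee_fin.
by apply: eq_integral => y _; rewrite IH fE.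
Qed.

Lemma psum_gt0 k : (forall j, {ae P, forall w, (0 < Y j w)%R}) ->
  {ae P, forall w, (0 < psum k.+1 w)%R}.
Proof.
move=> Y0; elim: k => [|k IH].
  by apply: filterS (Y0 0%N) => w; rewrite psumS psum0 add0r.
by apply: filterS2 IH (Y0 k.+1) => w ? ?; rewrite psumS addr_gt0.
Qed.

Lemma psum_nonlattice k : ~ lattice P (Y 0%N) ->
  ~ lattice P (psum k.+1).
Proof.
move=> Ynl [a [h [h0]]]; set L := [set w | _] => PL; apply: Ynl.
pose A : set R := [set x | exists k : int, x = (a + k%:~R * h)%R].
have mA : measurable A by exact: measurable_lattice.
pose f (u : R) := (\1_(~` A) u)%:E : \bar R.
have mf : measurable_fun setT f.
  by apply/measurable_EFinP; apply: measurable_indic; exact: measurableC.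
have f0 u : 0 <= f u by rewrite lee_fin.
have fE (Z : {RV P >-> R}) : \int[P]_w f (Z w) = P (Z @^-1` (~` A)).
  by rewrite /f integral_indic_preimage//; exact: measurableC.
have PZ (Z : {RV P >-> R}) : measurable (Z @^-1` A) by exact: measurable_funPTI.
have : \int[distribution P (psum k)]_s \int[P]_w f (Y k w + s)%R = 0.
  rewrite -(integral_independent2 (f := fun z : R * R => f (z.1 + z.2)%R))//.
  - under eq_integral do rewrite /= addrC -psumS.
    by rewrite fE preimage_setC; exact: (probability_setC0 P (PZ _)).2.
  - by move=> B C YB SC; rewrite setIC (@independent2_psum k)// muleC.
  - by apply: measurableT_comp => //; exact: measurable_funD.
(* [g s] is the probability that the last summand, shifted by [s], misses the lattice; its integral
   over the law of the other summands is 0. *)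
set g := (fun s : R => \int[P]_w f (Y k w + s)%R) => intg.
have g0 s : 0 <= g s by exact: integral_ge0.
have mg : measurable_fun setT g.
  apply: (measurable_fun_fubini_tonelli_G (m1 := P)
    (fun z : T * R => f (Y k z.1 + z.2)%R)) => //.
  apply: measurableT_comp => //; apply: measurable_funD => //.
  exact: measurableT_comp.
have : ae_eq (distribution P (psum k)) setT g (cst 0).
  apply/ae_eq_integral_abs => //.
  by under eq_integral do rewrite gee0_abs//.
case=> N [mN PN0 gN].
(* [g] vanishes outside a null set, and a null set of a probability is not the whole line, so some
   value [s] of the other summands can be frozen. *)
have [s gs0] : exists s, g s = 0.
  apply: contrapT => gn0.
  have NT : N = setT.
    by apply/seteqP; split=> // s _; apply: gN => /= gs; apply: gn0; exists s; exact: gs.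
  rewrite NT in PN0; have := probability_setT (distribution P (psum k)).
  by move=> /(etrans (esym PN0))/esym/eqP; rewrite onee_eq0.
pose g0f (u : R) := f (u + s)%R.
have Y0s : \int[P]_w f (Y 0%N w + s)%R = 0.
  rewrite -gs0 /g -[LHS]/(\int[P]_w g0f (Y 0%N w)) -(integral_iid k)//;
    last by move=> u; exact: f0.
  by apply: measurableT_comp => //; exact: measurable_funD.
exists (a - s)%R, h; split=> //.
rewrite (_ : [set w | _] = (fun w => Y 0%N w + s)%R @^-1` A); last first.
  apply/seteqP; split=> w /= [n]; exists n.
    by rewrite p addrAC subrK.
  by rewrite addrAC -p addrK.
pose Ys : {RV P >-> R} := (Y 0%N \+ cst s)%R.
apply/(probability_setC0 P (PZ Ys)).
by have := fE Ys; rewrite preimage_setC => <-.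
Qed.

End partial_sums.

(** * Independence in the group claims model *)

Section vectors.
Context {disp : measure_display} {T : measurableType disp}.
Context {dV : measure_display} {V : measurableType dV}.

Lemma measurable_vec n (X : 'I_n -> T -> V) :
  (forall s, measurable_fun setT (X s)) -> measurable_fun setT (vec X).
Proof.
move=> mX; apply/measurable_fun_tnthP => s.
by rewrite (_ : _ \o _ = X s)//; apply/funext => w /=; rewrite tnth_mktuple.
Qed.

Lemma g_sigma_algebra_preimage_vec n (X : 'I_n -> T -> V) s :
  g_sigma_algebra_preimage (X s) `<=` g_sigma_algebra_preimage (vec X).
Proof.
move=> _ [B mB <-]; exists ((fun t => tnth t s) @^-1` B).
  by rewrite -[X in measurable X]setTI; exact: measurable_tnth.
by apply/seteqP; split=> w /= [_]; rewrite tnth_mktuple.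
Qed.

(** The type is countable and its points are measurable; hence every function of a composition
    vector is measurable. *)
Lemma measurable_tuple_nat n (B : set (n.-tuple nat)) : measurable B.
Proof.
apply: countable_measurable => [t|]; last exact: countableP.
rewrite (_ : [set t] = \bigcap_(s : 'I_n) ((fun u => tnth u s) @^-1` [set tnth t s])).
  apply: fin_bigcap_measurable => // s _.
  by rewrite -[X in measurable X]setTI; exact: measurable_tnth.
apply/seteqP; split=> [u -> //|u ut].
by apply/eq_from_tnth => s; exact: ut.
Qed.

End vectors.

Section vec_rv.
Context {disp : measure_display} {T : measurableType disp} {R : realType}.
Variable P : probability T R.
Context {dV : measure_display} {V : measurableType dV}.

(** A separate name for [vec] on random variables, to which the structure of a random variable is
    attached. *)
Definition vec_rv n (X : 'I_n -> {RV P >-> V}) : T -> n.-tuple V :=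
  vec (X : 'I_n -> T -> V).

HB.instance Definition _ n (X : 'I_n -> {RV P >-> V}) :=
  isMeasurableFun.Build _ _ _ _ (vec_rv X)
    (measurable_vec (fun s => @measurable_funPT _ _ _ _ (X s))).

End vec_rv.

Section model_independence.
Context {disp : measure_display} {T : measurableType disp} {R : realType}.
Variables (P : probability T R) (d : nat) (M : group_claims_model P d).

(* [inl (inl tt)] is the counting process, [inl (inr i)] the composition of group
   [i], and [inr (i, j)] the vector of [j]-th claim sizes of group [i]. *)
Definition source (k : unit + nat + nat * nat) : set (set T) :=
  match k with
  | inl (inl _) => sigma_process (Ncount M)
  | inl (inr i) => g_sigma_algebra_preimage (vec (Uvec M i : 'I_d -> T -> nat))
  | inr (i, j) => g_sigma_algebra_preimage (vec (Ytilde M i j : 'I_d -> T -> R))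
  end.

Lemma source_measurable k : source k `<=` measurable.
Proof.
case: k => [[u|i]|[i j]] /=.
- exact: sigma_family_measurable.
- exact: (@g_sigma_algebra_preimage_measurable _ _ _ P _ _ (vec_rv (Uvec M i))).
- exact: (@g_sigma_algebra_preimage_measurable _ _ _ P _ _ (vec_rv (Ytilde M i j))).
Qed.

Lemma sourceI k : setI_closed (source k).
Proof.
case: k => [[u|i]|[i j]] /=; try exact: g_sigma_algebra_preimageI.
by have [] := (sigma_algebraP (fun X _ => @subsetT T X)).1
  (smallest_sigma_algebra setT
    (\bigcup_(t in [set t : R | 0 <= t]) g_sigma_algebra_preimage (Ncount M t))).
Qed.

Lemma sourceT k : source k setT.
Proof.
case: k => [[u|i]|[i j]] /=; try exact: g_sigma_algebra_preimageT.
by have [] := (sigma_algebraP (fun X _ => @subsetT T X)).1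
  (smallest_sigma_algebra setT
    (\bigcup_(t in [set t : R | 0 <= t]) g_sigma_algebra_preimage (Ncount M t))).
Qed.

(** Assembled in two steps: the counting process joins the compositions, then the claim sizes join
    both. *)
Lemma source_independent : mutually_independent P source.
Proof.
have indNU := @mutually_independent_sum _ _ _ P _ _ _ _
  (@mutually_independent_unit _ _ _ P (fun=> sigma_process (Ncount M))) (Uvec_iid M).1.
have := @mutually_independent_sum _ _ _ P _ _ _ _ (indNU _) (Ytilde_iid M).1.
move=> H; apply: mutually_independent_sub (H _ _) => [[[u|i]|[i j]]//| |].
  apply: independent2_sub (Ncount_independent_U (g := M)) => //.
  by apply: sub_sigma_sigma => A [].
move=> A B AN BY; rewrite setIC muleC; apply: (Ytilde_independent (g := M)) => //.
move: A AN; apply: sub_sigma_sigma => A [[u|i] _ FA]; apply: sub_sigma_algebra.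
  by left.
by right; exact: (sub_sigma_family (i := i)).
Qed.

End model_independence.

Lemma random_sumE (R : realType) n (x : nat -> R) :
  random_sum n x = \sum_(i < n) x i.
Proof. by rewrite /random_sum; case: n => [|//]; rewrite big_ord0. Qed.

Section claim_independence.
Context {disp : measure_display} {T : measurableType disp} {R : realType}.
Variables (P : probability T R) (d : nat) (M : group_claims_model P d).

Definition typed_claims i (s : 'I_d) (j : nat) : {RV P >-> R} := Ytilde M i j s.

Lemma claimE i w :
  claim M i w = \sum_(s < d) psum (typed_claims i s) (Uvec M i s w) w.
Proof.
by rewrite /claim /group_claim; apply: eq_bigr => s _; rewrite random_sumE.
Qed.

(** [measurable_group_claim] is reused with the sample space carrying the smaller sigma-algebra
    [<<s G>>]. *)
Lemma claim_sigma (G : set (set T)) i :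
  (forall s, g_sigma_algebra_preimage (Uvec M i s) `<=` <<s G >>) ->
  (forall j s, g_sigma_algebra_preimage (Ytilde M i j s) `<=` <<s G >>) ->
  g_sigma_algebra_preimage (claim M i) `<=` <<s G >>.
Proof.
move=> UG YG; apply/g_sigma_algebra_preimageP.
(* A placeholder: measurability with respect to <<s G>> is stated for some
   probability on that sigma-algebra. *)
pose P' : probability (g_sigma_algebraType G) R :=
  @dirac _ (g_sigma_algebraType G) point R.
have mU s := (g_sigma_algebra_preimageP G (Uvec M i s)).1 (UG s).
have mY j s := (g_sigma_algebra_preimageP G (Ytilde M i j s)).1 (YG j s).
pose U' s : {mfun g_sigma_algebraType G >-> nat} :=
  HB.pack (Uvec M i s : g_sigma_algebraType G -> nat)
    (isMeasurableFun.Build _ _ _ _ _ (mU s)).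
pose Y' j s : {mfun g_sigma_algebraType G >-> R} :=
  HB.pack (Ytilde M i j s : g_sigma_algebraType G -> R)
    (isMeasurableFun.Build _ _ _ _ _ (mY j s)).
exact: (@measurable_group_claim _ _ _ P' d U' Y').
Qed.

Lemma sub_sigma_source (K : set (unit + nat + nat * nat)) k :
  K k -> source M k `<=` <<s \bigcup_(k' in K) source M k' >>.
Proof. by move=> Kk A kA; apply: sub_sigma_algebra; exists k. Qed.

Lemma Uvec_sub_source i s :
  g_sigma_algebra_preimage (Uvec M i s) `<=` source M (inl (inr i)).
Proof. exact: g_sigma_algebra_preimage_vec. Qed.

Lemma Ytilde_sub_source i j s :
  g_sigma_algebra_preimage (Ytilde M i j s) `<=` source M (inr (i, j)).
Proof. exact: g_sigma_algebra_preimage_vec. Qed.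

Lemma source_group (I : eqType) (phi : unit + nat + nat * nat -> I) :
  mutually_independent P
    (fun x => <<s \bigcup_(k in [set k | phi k = x]) source M k >>).
Proof.
apply: mutually_independent_group.
- exact: sourceI.
- exact: sourceT.
- exact: source_measurable.
- exact: source_independent.
Qed.

Lemma claim_independent :
  mutually_independent P (fun i => g_sigma_algebra_preimage (claim M i)).
Proof.
(* Every source needs a block; the counting process is put with group 0, which only enlarges that
   block. *)
have H := @source_group nat (fun k => match k with
  | inl (inl _) => 0%N | inl (inr i) => i | inr (i, _) => i end).
apply: mutually_independent_sub H.
move=> i; apply: claim_sigma => [s|j s].
  by apply: subset_trans (@Uvec_sub_source i s) _; exact: sub_sigma_source.
by apply: subset_trans (@Ytilde_sub_source i j s) _; exact: sub_sigma_source.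
Qed.

Lemma Ncount_independent_claim :
  independent2 P (sigma_process (Ncount M))
    (sigma_family setT (fun i => claim M i : T -> R)).
Proof.
have := @source_group _ (fun k => if k is inl (inl _) then true else false).
move=> /(mutually_independent_pair (i := true) (j := false) isT).
apply: independent2_sub; first exact: (@sub_sigma_source _ (inl (inl tt))).
apply: sub_sigma_sigma => A [i _]; move: A; apply: claim_sigma => [s|j s].
  by apply: subset_trans (@Uvec_sub_source i s) _; exact: sub_sigma_source.
by apply: subset_trans (@Ytilde_sub_source i j s) _; exact: sub_sigma_source.
Qed.

Lemma Uvec_independent_Ytilde i (A B : set T) :
  g_sigma_algebra_preimage (vec (Uvec M i : 'I_d -> T -> nat)) A ->
  <<s \bigcup_(js in [set: nat * 'I_d])
        g_sigma_algebra_preimage (Ytilde M i js.1 js.2) >> B ->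
  P (A `&` B) = (P A * P B)%E.
Proof.
have := @source_group _ (fun k => if k is inl _ then true else false).
move=> /(mutually_independent_pair (i := true) (j := false) isT) H UA YB.
apply: H; first exact: (@sub_sigma_source _ (inl (inr i))).
move: B YB; apply: sub_sigma_sigma => B [[j s] _ /= YB].
by apply: (@sub_sigma_source _ (inr (i, j))) => //; exact: (@Ytilde_sub_source i j s).
Qed.

Lemma typed_claims_law i s j (B : set R) : measurable B ->
  P (typed_claims i s j @^-1` B) = P (Ytilde11 M s @^-1` B).
Proof.
move=> mB.
pose C : set (d.-tuple R) := (fun t => tnth t s) @^-1` B.
have mC : measurable C by rewrite -[X in measurable X]setTI; exact: measurable_tnth.
have := (Ytilde_iid M).2 (i, j) (0%N, 0%N) C mC.
by rewrite /C /preimage /=; under eq_fun do rewrite tnth_mktuple;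
   under [in RHS]eq_fun do rewrite tnth_mktuple.
Qed.

Lemma typed_claims_iid i s : iid P (fun j => typed_claims i s j : T -> R).
Proof.
split; last by move=> j j' B mB; rewrite !typed_claims_law.
(* Blocks by claim number, all groups together; the sources on the left are put in block 0. *)
have H := @source_group nat (fun k => match k with
  | inl _ => 0%N | inr (_, j) => j end).
apply: mutually_independent_sub H.
move=> j; apply: subset_trans (@Ytilde_sub_source i j s) _.
exact: sub_sigma_source.
Qed.

End claim_independence.

(** * The law of a group and of its claim *)

Section group_law.
Context {disp : measure_display} {T : measurableType disp} {R : realType}.
Variables (P : probability T R) (d : nat) (M : group_claims_model P d).
Hypothesis d_gt0 : (0 < d)%N.

(* The law of [Uvec] is the law of [thinned] conditioned on being nonzero. *)
Definition thinned (w : T) : d.-tuple nat :=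
  vec (fun s w => ((w \in Aset M 0%N s) * Utilde1 M s w)%N) w.

Definition single (s : 'I_d) (k : nat) : d.-tuple nat :=
  [tuple if r == s then k else 0%N | r < d].

Lemma total_rate_gt0 : 0 < total_rate M.
Proof.
rewrite /total_rate; case: d M d_gt0 => // n M' _.
rewrite big_ord_recl ltr_pwDl ?rate_gt0// sumr_ge0// => s _.
by rewrite ltW// rate_gt0.
Qed.

Lemma thinnedE s w : Aset M 0%N s w -> thinned w = single s (Utilde1 M s w).
Proof.
move=> Asw; apply/eq_from_tnth => r; rewrite !tnth_mktuple.
case: eqP => [->|/eqP rs]; first by rewrite mem_set// mul1n.
rewrite memNset// => Arw.
move/negP: rs; apply; apply/eqP.
by apply: (Aset_disjoint (g := M) (i := 0%N)) => //; exists w.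
Qed.

Lemma measurable_thinned : measurable_fun setT thinned.
Proof.
move=> _ B mB; rewrite setTI.
have -> : thinned @^-1` B =
    \bigcup_(s : 'I_d) (Aset M 0%N s `&` Utilde1 M s @^-1` (single s @^-1` B)).
  apply/seteqP; split=> [w Bw|w [s _ [Asw /= Bw]]]; last first.
    by rewrite /preimage /= (thinnedE Asw).
  have [s _ Asw] : (\bigcup_s Aset M 0%N s) w by rewrite (Aset_cover M 0%N).
  by exists s => //; split=> //=; rewrite -thinnedE.
apply: fin_bigcup_measurable => // s _; apply: measurableI.
  exact: Aset_measurable.
exact: measurable_funPTI.
Qed.

HB.instance Definition _ :=
  isMeasurableFun.Build _ _ _ _ thinned measurable_thinned.

Local Open Scope ereal_scope.

Lemma measurable_fun_tuple_nat (g : d.-tuple nat -> \bar R) :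
  measurable_fun setT g.
Proof. by move=> _ B mB; exact: measurable_tuple_nat. Qed.

(** On the event of type [s] the vector is a function of [Utilde1 M s], which is independent of that
    event. *)
Lemma integral_thinned (g : d.-tuple nat -> \bar R) : (forall t, 0 <= g t) ->
  \int[P]_w g (thinned w) =
  \sum_(s < d) (rate M s / total_rate M)%:E *
               \int[P]_w g (single s (Utilde1 M s w)).
Proof.
move=> g0.
have mg (F : {RV P >-> d.-tuple nat}) : measurable_fun setT (fun w => g (F w)).
  apply: (@measurableT_comp _ _ _ _ _ _ g) => //.
  exact: measurable_fun_tuple_nat.
have AT : \big[setU/set0]_(s < d) Aset M 0%N s = setT.
  rewrite -bigcup_seq -(Aset_cover M 0%N).
  by apply/seteqP; split=> w [s _ Asw]; exists s => //=; rewrite mem_index_enum.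
rewrite -AT ge0_integral_bigsetU ?AT//=; last 3 first.
- by move=> s; exact: Aset_measurable.
- exact: index_enum_uniq.
- exact: sub_trivIset (@Aset_disjoint _ _ _ _ _ M 0%N).
apply: eq_bigr => s _; rewrite -(Aset_prob M 0%N).
transitivity (\int[P]_(w in Aset M 0%N s) (g \o single s) (Utilde1 M s w)).
  by apply: eq_integral => w; rewrite inE => Asw; rewrite (thinnedE Asw).
rewrite integral_restrict_independent//; last by move=> k; exact: g0.
  exact: Aset_measurable.
move=> B mB; apply: (Aset_independent_Utilde (g := M)).
  by apply: sub_sigma_algebra; exists 0%N => //; exists s.
apply: (sub_sigma_family (i := 0%N)) => //.
apply: (@g_sigma_algebra_preimage_vec _ _ _ _ _ _ s).
by exists B => //; rewrite setTI.
Qed.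

(** Reads the weighted average defining [p0] as the probability of an empty group:
    [integral_thinned] at the indicator of the zero vector. *)
Lemma p0E : (p0 M)%:E = P [set w | thinned w = [tuple 0%N | s < d]].
Proof.
pose g (t : d.-tuple nat) : \bar R := (\1_[set [tuple 0%N | s < d]] t)%:E.
transitivity (\int[P]_w g (thinned w)); last first.
  exact: (integral_indic_preimage _ (measurable_tuple_nat _)).
rewrite integral_thinned//; last by move=> t; rewrite lee_fin.
have ig s : \int[P]_w g (single s (Utilde1 M s w)) = (pr_eq P (Utilde1 M s) 0%N)%:E.
  transitivity (\int[P]_w (\1_[set 0%N] (Utilde1 M s w))%:E).
    apply: eq_integral => w _; rewrite /g !indicE; congr (nat_of_bool _)%:R%:E.
    apply/idP/idP; rewrite !inE /=.
      by move=> /(congr1 (fun t => tnth t s)); rewrite !tnth_mktuple eqxx.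
    move=> ->; apply/eq_from_tnth => r; rewrite !tnth_mktuple.
    by case: ifP.
  rewrite integral_indic_preimage// /pr_eq fineK//.
  have : measurable (Utilde1 M s @^-1` [set 0%N]) by exact: measurable_funPTI.
  exact: fin_num_measure.
rewrite (eq_bigr _ (fun s _ => congr1 (fun x => _ * x) (ig s))).
under eq_bigr do rewrite -EFinM.
rewrite sumEFin; congr EFin; rewrite /p0 /empty_group_prob mulr_suml.
by apply: eq_bigr => s _; rewrite [RHS]mulrAC [in RHS](mulrC (rate M s)).
Qed.

Lemma p0_lt1 : (p0 M < 1)%R. Proof. exact: empty_group_prob_lt1. Qed.

Lemma integral_Uvec i (g : d.-tuple nat -> \bar R) : (forall t, 0 <= g t) ->
  (1 - p0 M)%:E * \int[P]_w g (vec_rv (Uvec M i) w) +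
    (p0 M)%:E * g [tuple 0%N | s < d] =
  \sum_(s < d) (rate M s / total_rate M)%:E *
               \int[P]_w g (single s (Utilde1 M s w)).
Proof.
move=> g0; rewrite -integral_thinned//.
have mg := measurable_fun_tuple_nat g.
pose D : set (d.-tuple nat) := [set t | t != [tuple 0%N | s < d]].
have mD : measurable D by exact: measurable_tuple_nat.
have PD : P (thinned @^-1` D) = (1 - p0 M)%:E.
  have mD' : measurable (thinned @^-1` (~` D)).
    rewrite -[X in measurable X]setTI; apply: measurable_thinned => //.
    exact: measurable_tuple_nat.
  rewrite -(setCK D) preimage_setC.
  have -> : P (~` (thinned @^-1` (~` D))) = 1 - P (thinned @^-1` (~` D)).
    exact: probability_setC.
  rewrite EFinB p0E; congr (1 - P _); apply/seteqP; split=> w /=.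
    by move=> /negP; rewrite negbK => /eqP.
  by move=> ->; apply/negP; rewrite negbK.
have p0_pos : (0 < 1 - p0 M)%R by rewrite subr_gt0 p0_lt1.
pose q : {nonneg R} := NngNum (ltW p0_pos).
(* On nonzero vectors, multiplying the conditional law by [1 - p0] gives back the unconditional
   one. *)
have UB B : measurable B -> B `<=` D ->
    mscale q (distribution P (vec_rv (Uvec M i))) B = distribution P thinned B.
  move=> mB BD; rewrite /mscale /=.
  rewrite -[distribution P (vec_rv _) B]/(P (vec (Uvec M i : 'I_d -> T -> nat) @^-1` B)).
  rewrite Uvec_law// /cond_prob.
  set x := fine _; set y := fine _.
  have -> : y = (1 - p0 M)%R by rewrite /y -[P _]/(P (thinned @^-1` D)) PD.
  have -> : x = fine (P (thinned @^-1` B)).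
    by rewrite /x -[X in P X]/(thinned @^-1` (B `&` D)) setIidl.
  rewrite -EFinM mulrC divfK ?gt_eqF// fineK//.
  apply: fin_num_measure; rewrite -[X in measurable X]setTI.
  exact: measurable_thinned.
have intD : (1 - p0 M)%:E * \int[P]_w g (vec_rv (Uvec M i) w) =
    \int[P]_(w in thinned @^-1` D) g (thinned w).
  rewrite -(@ge0_integral_distribution _ _ _ _ _ P (vec_rv (Uvec M i)) g)//.
  rewrite -(@ge0_integral_mscale _ _ _ (distribution P (vec_rv (Uvec M i))) _ _ q)//.
  rewrite -(@ge0_integral_pushforward _ _ _ _ _ thinned measurable_thinned P D g)//;
    last exact: measurable_funTS.
  (* The conditioned vector gives no mass to the complement of [D], so its integral may be taken
     over [D] only. *)
  rewrite -(setUv D) ge0_integral_setU ?setUv//; last 2 first.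
  - exact: measurableC.
  - by apply/disj_set2P; rewrite setICr.
  rewrite [X in _ + X]null_set_integral ?adde0; last 3 first.
  - exact: measurableC.
  - exact: measurable_funTS.
  - rewrite /mscale /=.
    rewrite -[RHS](mule0 (1 - p0 M)%:E); congr (_ * _).
    rewrite -[LHS]/(P (vec (Uvec M i : 'I_d -> T -> nat) @^-1` (~` D))).
    rewrite Uvec_law /cond_prob; last exact: measurableC.
    set x := fine (P (_ `&` _)).
    suff -> : x = 0%R by rewrite mul0r.
    by rewrite /x [X in P X](_ : _ = set0) ?measure0// -subset0 => w [].
  apply: eq_measure_integral => B mB BD; exact: UB.
have mgV : measurable_fun setT (fun w => g (thinned w)).
  by apply: (@measurableT_comp _ _ _ _ _ _ g) => //; exact: measurable_thinned.
have mtD B : measurable (thinned @^-1` B).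
  rewrite -[X in measurable X]setTI; apply: measurable_thinned => //.
  exact: measurable_tuple_nat.
(* Off [D] the thinned vector is the zero tuple, an event of probability [p0]; this yields the added
   term. *)
rewrite intD -[in RHS](setUv (thinned @^-1` D)) ge0_integral_setU ?setUv//.
- congr (_ + _). rewrite preimage_setC.
  rewrite (eq_integral (cst (g [tuple 0%N | s < d]))); last first.
    by move=> w; rewrite inE /= => /negP; rewrite negbK => /eqP ->.
  rewrite integral_cst// muleC p0E; congr (_ * P _); apply/seteqP; split=> w /=.
    by move=> ->; apply/negP; rewrite negbK.
  by move=> /negP; rewrite negbK => /eqP.
- by rewrite preimage_setC.
- by apply/disj_set2P; rewrite setICr.
Qed.

End group_law.

(** * The thinning identity for claims *)

Section claim_law.
Context {disp : measure_display} {T : measurableType disp} {R : realType}.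
Variables (P : probability T R) (d : nat) (M : group_claims_model P d).
Local Open Scope ereal_scope.

(** The law of one summand determines that of the sum, so the claim sizes of group [i] can be
    exchanged for those of group 0. *)
Lemma integral_psum_law (Y Y' : nat -> {RV P >-> R}) k (f : R -> \bar R) :
  iid P (fun j => Y j : T -> R) -> iid P (fun j => Y' j : T -> R) ->
  (forall B, measurable B -> P (Y 0%N @^-1` B) = P (Y' 0%N @^-1` B)) ->
  measurable_fun setT f -> (forall x, 0 <= f x) ->
  \int[P]_w f (psum Y k w) = \int[P]_w f (psum Y' k w).
Proof.
move=> iidY iidY' YY'; elim: k f => [|k IH] f mf f0.
  by apply: eq_integral => w _; rewrite !psum0.
rewrite !integral_psumS//.
rewrite (eq_measure_integral (distribution P (Y' 0%N))); last first.
  by move=> A mA _; exact: YY'.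
apply: eq_integral => y _; apply: (IH (fun x => f (x + y)%R)) => //.
by apply: measurableT_comp => //; exact: measurable_funD.
Qed.

Definition fixed_claim i (v : d.-tuple nat) (w : T) : R :=
  (\sum_(s < d) psum (typed_claims M i s) (tnth v s) w)%R.

Lemma fixed_claim_sigma i v : g_sigma_algebra_preimage (fixed_claim i v) `<=`
  <<s \bigcup_(js in [set: nat * 'I_d])
        g_sigma_algebra_preimage (Ytilde M i js.1 js.2) >>.
Proof.
apply/g_sigma_algebra_preimageP; apply: measurable_sum => s.
apply: measurable_sum => j; apply/g_sigma_algebra_preimageP => A YA.
by apply: sub_sigma_algebra; exists (nat_of_ord j, s).
Qed.

Lemma measurable_fixed_claim i v : measurable_fun setT (fixed_claim i v).
Proof. by apply: measurable_sum => s; exact: measurable_psum. Qed.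

HB.instance Definition _ i v :=
  isMeasurableFun.Build _ _ _ _ (fixed_claim i v) (measurable_fixed_claim i v).

(** On the event that the composition is [v] the claim equals [fixed_claim i v], which is
    independent of that event. *)
Lemma integral_claim_fixed i (f : R -> \bar R) :
  measurable_fun setT f -> (forall x, 0 <= f x) ->
  \int[P]_w f (claim M i w) =
  \int[P]_w \int[P]_w' f (fixed_claim i (vec_rv (Uvec M i) w) w').
Proof.
move=> mf f0.
have mfS v : measurable_fun setT (fun w => f (fixed_claim i v w)).
  by apply: measurableT_comp.
have mV v : measurable [set w | vec_rv (Uvec M i) w = v].
  exact: (measurable_funPTI (vec_rv (Uvec M i)) (measurable_tuple_nat [set v])).
apply: (integral_countable_partition (V := vec_rv (Uvec M i))) => //.
- exact: measurableT_comp.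
- apply: (@measurableT_comp _ _ _ _ _ _
    (fun v => \int[P]_w' f (fixed_claim i v w'))) => //.
  exact: measurable_fun_tuple_nat.
- by move=> w; exact: integral_ge0.
move=> v.
rewrite (eq_integral (fun w => f (fixed_claim i v w))); last first.
  move=> w; rewrite inE /= => <-; congr f; rewrite claimE.
  by apply: eq_bigr => s _; rewrite tnth_mktuple.
rewrite [RHS](eq_integral (cst (\int[P]_w' f (fixed_claim i v w')))); last first.
  by move=> w; rewrite inE /= => ->.
rewrite integral_cst// muleC; apply: integral_restrict_independent => // B mB.
apply: (@Uvec_independent_Ytilde _ _ _ _ _ M i _ _).
  exists [set v]; first exact: measurable_tuple_nat.
  by rewrite setTI.
by apply: (@fixed_claim_sigma i v); exists B => //; rewrite setTI.
Qed.

(** This is [integral_Uvec] at [H v], the mean of [f] over a claim of frozen composition [v]. At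
    [single s k] only the type [s] remains in the sum. *)
Lemma integral_claim i (f : R -> \bar R) :
  measurable_fun setT f -> (forall x, 0 <= f x) ->
  (1 - p0 M)%:E * \int[P]_w f (claim M i w) + (p0 M)%:E * f 0%R =
  \sum_(s < d) (rate M s / total_rate M)%:E *
    \int[P]_w \int[P]_w' f (psum (typed_claims M 0%N s) (Utilde1 M s w) w').
Proof.
move=> mf f0; rewrite integral_claim_fixed//.
pose H v := \int[P]_w' f (fixed_claim i v w').
have -> : f 0%R = H [tuple 0%N | s < d].
  rewrite /H (eq_integral (cst (f 0%R))); last first.
    move=> w _; congr f; rewrite /fixed_claim big1// => s _.
    by rewrite tnth_mktuple psum0.
  by rewrite integral_cst_probability.
rewrite integral_Uvec//; last by move=> v; exact: integral_ge0.
apply: eq_bigr => s _; congr (_ * _); apply: eq_integral => w _.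
rewrite -(@integral_psum_law (typed_claims M i s))//; last 3 first.
- exact: typed_claims_iid.
- exact: typed_claims_iid.
- by move=> B mB; rewrite !typed_claims_law.
apply: eq_integral => w' _; congr f.
rewrite /fixed_claim (bigD1 s)//= tnth_mktuple eqxx big1 ?addr0// => r rs.
by rewrite tnth_mktuple (negbTE rs) psum0.
Qed.

End claim_law.

(** * Exponential, first and second moments of partial sums *)

Section partial_sum_moments.
Context {disp : measure_display} {T : measurableType disp} {R : realType}.
Variables (P : probability T R) (Y : nat -> {RV P >-> R}).
Hypothesis iidY : iid P (fun j => Y j : T -> R).
Local Open Scope ereal_scope.

Lemma integral_expR_psum (z a : R) k :
  \int[P]_w (expR (z * Y 0%N w))%:E = a%:E ->
  \int[P]_w (expR (z * psum Y k w))%:E = (a ^+ k)%:E.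
Proof.
move=> Ya; pose f (x : R) := (expR (z * x))%:E.
have mf : measurable_fun setT f.
  by apply/measurable_EFinP; apply: measurableT_comp.
have f0 x : 0 <= f x by rewrite lee_fin expR_ge0.
elim: k => [|k IH].
  rewrite -[RHS](integral_cst_probability P); apply: eq_integral => w _.
  by rewrite psum0 mulr0 expR0.
transitivity (\int[P]_w (f (psum Y k w) * f (Y k w))).
  by apply: eq_integral => w _; rewrite -EFinM psumS mulrDr expRD.
rewrite (integral_mul_independent2 (@independent2_psum _ _ _ _ _ iidY k))//.
by rewrite (integral_iid iidY)// IH Ya -EFinM exprSr.
Qed.

Hypothesis Y_gt0 : forall j, {ae P, forall w, (0 < Y j w)%R}.

Lemma psum_ge0 k : {ae P, forall w, (0 <= psum Y k w)%R}.
Proof.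
case: k => [|k]; first by apply: aeW => w; rewrite psum0.
by apply: filterS (psum_gt0 k Y_gt0) => w /ltW.
Qed.

(** Absolute values keep the integrands nonnegative, and they are additive here because the summands
    are almost surely positive. *)
Lemma integral_norm_psum (m : R) k :
  \int[P]_w (`|Y 0%N w|)%:E = m%:E ->
  \int[P]_w (`|psum Y k w|)%:E = (k%:R * m)%:E.
Proof.
move=> Ym; elim: k => [|k IH].
  rewrite mul0r; apply: integral0_eq => w _.
  by rewrite psum0 normr0.
transitivity (\int[P]_w ((`|psum Y k w|)%:E + (`|Y k w|)%:E)).
  apply: ge0_ae_eq_integral => //.
  - by apply/measurable_EFinP; exact: measurableT_comp.
  - by apply: emeasurable_funD; apply/measurable_EFinP; exact: measurableT_comp.
  - by move=> w _; rewrite adde_ge0.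
  - apply: filterS2 (psum_ge0 k) (Y_gt0 k) => w S0 Y0 _.
    by rewrite psumS -EFinD !ger0_norm// ?addr_ge0// ltW.
rewrite ge0_integralD//; last 2 first.
- by apply/measurable_EFinP; exact: measurableT_comp.
- by apply/measurable_EFinP; exact: measurableT_comp.
rewrite IH (@integral_iid _ _ _ _ _ iidY k (fun x => `|x|%:E))//; last first.
  by apply/measurable_EFinP; exact: normr_measurable.
by rewrite Ym -EFinD -natr1 mulrDl mul1r.
Qed.

(** There are [k] squares and [k ^+ 2 - k] ordered products of distinct independent summands. *)
Lemma integral_sqr_psum (m q : R) k :
  \int[P]_w (`|Y 0%N w|)%:E = m%:E -> \int[P]_w (Y 0%N w ^+ 2)%:E = q%:E ->
  \int[P]_w (psum Y k w ^+ 2)%:E = (k%:R * q + (k%:R ^+ 2 - k%:R) * m ^+ 2)%:E.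
Proof.
move=> Ym Yq; elim: k => [|k IH].
  rewrite [RHS](_ : _ = 0); last by congr EFin; ring.
  by apply: integral0_eq => w _; rewrite psum0 expr0n.
have msq (Z : {RV P >-> R}) : measurable_fun setT (fun w => (Z w ^+ 2)%:E).
  by apply/measurable_EFinP; exact: measurable_funX.
have mno (Z : {RV P >-> R}) : measurable_fun setT (fun w => (`|Z w|)%:E).
  by apply/measurable_EFinP; exact: measurableT_comp.
have mno1 : measurable_fun setT (fun x : R => `|x|%:E).
  by apply/measurable_EFinP; exact: normr_measurable.
transitivity (\int[P]_w ((psum Y k w ^+ 2)%:E + (Y k w ^+ 2)%:E +
    (2%:E * ((`|psum Y k w|)%:E * (`|Y k w|)%:E)))).
  apply: ge0_ae_eq_integral => //.
  - apply: emeasurable_funD; first exact: emeasurable_funD.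
    by apply: emeasurable_funM => //; exact: emeasurable_funM.
  - by move=> w _; rewrite lee_fin sqr_ge0.
  - by move=> w _; rewrite !adde_ge0// ?lee_fin ?sqr_ge0// !mule_ge0// lee_fin.
  - apply: filterS2 (psum_ge0 k) (Y_gt0 k) => w S0 Y0 _.
    rewrite psumS -!EFinM -!EFinD !ger0_norm// ?ltW//; congr EFin; ring.
rewrite ge0_integralD//; last 3 first.
- by move=> w _; rewrite adde_ge0// lee_fin sqr_ge0.
- exact: emeasurable_funD.
- by apply: emeasurable_funM => //; exact: emeasurable_funM.
rewrite ge0_integralD//; last 2 first.
- by move=> w _; rewrite lee_fin sqr_ge0.
- by move=> w _; rewrite lee_fin sqr_ge0.
rewrite ge0_integralZl//; last exact: emeasurable_funM.
rewrite (integral_mul_independent2 (f := fun x : R => `|x|%:E)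
  (g := fun x : R => `|x|%:E) (@independent2_psum _ _ _ _ _ iidY k))//.
rewrite IH (integral_norm_psum k Ym).
rewrite (@integral_iid _ _ _ _ _ iidY k (fun x => `|x|%:E))// Ym.
rewrite (@integral_iid _ _ _ _ _ iidY k (fun x => (x ^+ 2)%:E))//; last 2 first.
- by apply/measurable_EFinP; exact: measurable_funX.
- by move=> x; rewrite lee_fin sqr_ge0.
rewrite Yq -!EFinM -!EFinD; congr EFin; rewrite -natr1; ring.
Qed.

End partial_sum_moments.

(** * Positivity, common law and non-lattice property of the claims *)

Section claim_properties.
Context {disp : measure_display} {T : measurableType disp} {R : realType}.
Variables (P : probability T R) (d : nat) (M : group_claims_model P d).
Hypothesis d_gt0 : (0 < d)%N.
Local Open Scope ereal_scope.

(** The unknown [x] may a priori be infinite; only the finiteness of [a] and [b] is used to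
    cancel. *)
Lemma thinning_solve (x : \bar R) (a b : R) :
  (1 - p0 M)%:E * x + a%:E = b%:E -> x = ((b - a) / (1 - p0 M))%:E.
Proof.
have p1 : (1 - p0 M != 0)%R by rewrite gt_eqF// subr_gt0 p0_lt1.
move=> E; rewrite mulrC EFinM [in RHS]EFinB -E addeK// muleA -EFinM mulVf//.
by rewrite mul1e.
Qed.

Lemma integral_claim_eq i (f : R -> \bar R) (a : R) (b : 'I_d -> R) :
  measurable_fun setT f -> (forall x, 0 <= f x) -> f 0%R = a%:E ->
  (forall s, \int[P]_w \int[P]_w'
     f (psum (typed_claims M 0%N s) (Utilde1 M s w) w') = (b s)%:E) ->
  \int[P]_w f (claim M i w) =
  ((\sum_(s < d) rate M s / total_rate M * b s - p0 M * a) / (1 - p0 M))%:E.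
Proof.
move=> mf f0 fa fb; apply: thinning_solve.
rewrite EFinM -fa integral_claim// -sumEFin; apply: eq_bigr => s _.
by rewrite fb.
Qed.

Lemma measurable_indic_ereal (A : set R) : measurable A ->
  measurable_fun setT (fun x : R => (\1_A x)%:E : \bar R).
Proof. by move=> mA; apply/measurable_EFinP; exact: measurable_indic. Qed.

Lemma psum_typed_claims_gt0 s k :
  {ae P, forall w, (0 < psum (typed_claims M 0%N s) k.+1 w)%R}.
Proof. by apply: psum_gt0 => j; exact: Ytilde_positive. Qed.

Lemma claim_gt0 i : {ae P, forall w, (0 < claim M i w)%R}.
Proof.
pose A : set R := `]-oo, 0%R]%classic.
have mA : measurable A by exact: measurable_itv.
have A0 : A 0%R by rewrite /A /= in_itv /=.
have mX (X : {RV P >-> R}) : measurable (X @^-1` A) by exact: measurable_funPTI.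
have : \int[P]_w (\1_A (claim M i w))%:E = 0.
  (* Almost surely, a partial sum is nonpositive only if it is empty, so type [s] contributes the
     probability that [Utilde1 M s] is 0. The weighted sum is [p0], which the term at 0 cancels. *)
  rewrite (integral_claim_eq (f := fun x => (\1_A x)%:E) i (a := 1%R)
     (b := fun s => pr_eq P (Utilde1 M s) 0%N)).
  - rewrite mulr1 [X in (X - _)%R](_ : _ = p0 M) ?subrr ?mul0r//.
    rewrite /p0 /empty_group_prob mulr_suml; apply: eq_bigr => s _.
    by rewrite mulrAC (mulrC (rate M s)).
  - exact: measurable_indic_ereal.
  - by move=> x; rewrite lee_fin.
  - by rewrite indicE mem_set.
  move=> s; transitivity (\int[P]_w (\1_[set 0%N] (Utilde1 M s w))%:E).
    apply: eq_integral => w _; rewrite integral_indic_preimage//.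
    case: (Utilde1 M s w) => [|k].
      rewrite indicE mem_set// -[RHS](probability_setT P); congr (P _).
      by apply/seteqP; split=> // w' _; rewrite /preimage /= psum0.
    rewrite indicE memNset//; apply: measure_negligible => //.
    apply: (negligibleS _ (psum_typed_claims_gt0 s k)) => w' /=.
    by rewrite /A /= in_itv /= leNgt => /negP.
  rewrite integral_indic_preimage// /pr_eq fineK//.
  have : measurable (Utilde1 M s @^-1` [set 0%N]) by exact: measurable_funPTI.
  exact: fin_num_measure.
rewrite integral_indic_preimage// => PA.
exists (claim M i @^-1` A); split=> // w /= /negP; rewrite -leNgt => c0.
by rewrite /A /= in_itv.
Qed.

(** The right side of the thinning identity does not depend on the group. *)
Lemma claim_identically_distributed i j (B : set R) : measurable B ->
  P (claim M i @^-1` B) = P (claim M j @^-1` B).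
Proof.
move=> mB.
have mf := measurable_indic_ereal mB.
have f0 x : 0 <= (\1_B x)%:E :> \bar R by rewrite lee_fin.
rewrite -!integral_indic_preimage//.
have := integral_claim M j mf f0; rewrite -(integral_claim M i mf f0).
rewrite !integral_indic_preimage// -EFinM.
move=> /esym/(congr1 (fun x => x - (p0 M * (\1_B 0%R))%:E)); rewrite !addeK// => E.
have p1 : (1 - p0 M != 0)%R by rewrite gt_eqF// subr_gt0 p0_lt1.
rewrite -(mul1e (P (claim M i @^-1` B))) -(mul1e (P (claim M j @^-1` B))).
by rewrite -(mulVf p1) EFinM -!muleA E.
Qed.

(** Otherwise [p0] would be a weighted average of numbers at least 1. *)
Lemma exists_nonempty_type : exists s, (pr_eq P (Utilde1 M s) 0%N < 1)%R.
Proof.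
apply: contrapT => noU.
have := p0_lt1 M; rewrite /p0 /empty_group_prob ltr_pdivrMr ?mul1r;
  last exact: total_rate_gt0.
rewrite ltNge => /negP; apply; apply: ler_sum => s _.
apply: ler_peMl; first by rewrite ltW// rate_gt0.
rewrite leNgt; apply/negP => Us.
by apply: noU; exists s.
Qed.

Lemma claim_nonlattice i : ~ lattice P (claim M i).
Proof.
move=> [a [h [h0 PL]]].
pose L : set R := [set x | exists k : int, x = (a + k%:~R * h)%R].
have mL : measurable L by exact: measurable_lattice.
(* Keeping only positive points makes the term at 0 vanish, whether or not 0 lies on the lattice. *)
pose A : set R := ~` L `&` `]0%R, +oo[%classic.
have mA : measurable A by apply: measurableI => //; exact: measurableC.
have mf := measurable_indic_ereal mA.
have f0 x : 0 <= (\1_A x)%:E :> \bar R by rewrite lee_fin.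
have PA : P (claim M i @^-1` A) = 0.
  apply/eqP; rewrite -measure_le0.
  rewrite (@le_trans _ _ (P (~` (claim M i @^-1` L))))//.
    apply: le_measure; rewrite ?inE.
    - exact: measurable_funPTI.
    - by apply: measurableC; exact: measurable_funPTI.
    - by move=> w [].
  rewrite le_eqVlt; apply/orP; left; apply/eqP.
  by apply/probability_setC0 => //; exact: measurable_funPTI.
have A0 : (\1_A 0%R)%:E = 0 :> \bar R.
  by rewrite indicE memNset// => -[_]; rewrite /= in_itv/= ltxx.
have := integral_claim M i mf f0.
rewrite A0 mule0 adde0 integral_indic_preimage// PA mule0 => /esym/eqP.
have [s Us] := exists_nonempty_type.
(* A vanishing sum of nonnegative terms: the term of the type [s] that is nonempty with positive
   probability is 0. *)
rewrite (bigD1 s)//= padde_eq0; last 2 first.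
- by apply: mule_ge0; [rewrite lee_fin divr_ge0// ltW// ?rate_gt0// total_rate_gt0|
    apply: integral_ge0 => w _; exact: integral_ge0].
- apply: sume_ge0 => r _.
  by apply: mule_ge0; [rewrite lee_fin divr_ge0// ltW// ?rate_gt0// total_rate_gt0|
    apply: integral_ge0 => w _; exact: integral_ge0].
case/andP => + _; rewrite mule_eq0 => /orP[|/eqP int0].
  by rewrite eqe gt_eqF// divr_gt0// ?rate_gt0// total_rate_gt0.
pose psi k := \int[P]_w' (\1_A (psum (typed_claims M 0%N s) k w'))%:E.
have psi0 k : 0 <= psi k by apply: integral_ge0.
have : ae_eq P setT (psi \o Utilde1 M s) (cst 0).
  apply/ae_eq_integral_abs => //; first exact: measurableT_comp.
  rewrite -[RHS]int0; apply: eq_integral => w _; by rewrite gee0_abs /=; [|exact: psi0].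
case=> N [mN PN0 psiN].
have mU0 : measurable (Utilde1 M s @^-1` [set 0%N]) by exact: measurable_funPTI.
(* If [psi] vanished at no positive integer, [Utilde1 M s] would be 0 almost surely, against the
   choice of [s]. *)
have [k pk0] : exists k, psi k.+1 = 0.
  apply: contrapT => npsi.
  have : P (~` (Utilde1 M s @^-1` [set 0%N])) = 0.
    apply: measure_negligible; first exact: measurableC.
    exists N; split=> // w /= Uw; apply: psiN => /= /(_ I).
    by case: (Utilde1 M s w) Uw => // k _ pk; apply: npsi; exists k.
  move=> /probability_setC0 => /(_ mU0) PU1; move: Us.
  by rewrite /pr_eq [P _]PU1 ltxx.
apply: (@psum_nonlattice _ _ _ _ (typed_claims M 0%N s) _ k).
- exact: typed_claims_iid.
- exact: (@Ytilde_nonlattice _ _ _ _ _ M).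
exists a, h; split=> //; rewrite -[LHS]/(P (psum (typed_claims M 0%N s) k.+1 @^-1` L)).
have mXL : measurable (psum (typed_claims M 0%N s) k.+1 @^-1` L).
  exact: measurable_funPTI.
apply/probability_setC0 => //.
apply: measure_negligible; first exact: measurableC.
have N1 : P.-negligible (psum (typed_claims M 0%N s) k.+1 @^-1` A).
  have PXA : P (psum (typed_claims M 0%N s) k.+1 @^-1` A) = 0.
    by rewrite -integral_indic_preimage.
  by apply/negligibleP; first exact: measurable_funPTI.
have N2 := psum_typed_claims_gt0 s k.
(* Off the lattice, the sum either lies in [A] or is nonpositive, and both events are negligible. *)
apply: negligibleS (negligibleU N1 N2) => w /= Lw.
have [S0|S0] := ltP 0%R (psum (typed_claims M 0%N s) k.+1 w); last by right.
by left; split=> //=; rewrite in_itv/= S0.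
Qed.

End claim_properties.

(** * Moments and transforms of the claims *)

Section first_two_moments.
Context {disp : measure_display} {T : measurableType disp} {R : realType}.
Variable P : probability T R.
Local Open Scope ereal_scope.

Lemma expectation_integral (X : T -> R) : 'E_P[X] = \int[P]_w (X w)%:E.
Proof. by rewrite unlock. Qed.

Lemma ge0_expectation (X : T -> R) : measurable_fun setT X ->
  {ae P, forall w, (0 <= X w)%R} -> 'E_P[X] = \int[P]_w (`|X w|)%:E.
Proof.
move=> mX X0; rewrite expectation_integral; apply: ae_eq_integral => //.
- exact/measurable_EFinP.
- by apply/measurable_EFinP; exact: measurableT_comp.
- by apply: filterS X0 => w X0 _; rewrite ger0_norm.
Qed.

Lemma ge0_meanE (X : T -> R) : measurable_fun setT X ->
  {ae P, forall w, (0 <= X w)%R} -> 'E_P[X] < +oo -> 'E_P[X] = (mean P X)%:E.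
Proof.
move=> mX X0 Xoo; rewrite /mean fineK// ge0_fin_numE//.
by rewrite ge0_expectation//; exact: integral_ge0.
Qed.

Lemma sqr_integrable_Lfun2 (X : T -> R) : measurable_fun setT X ->
  \int[P]_w (X w ^+ 2)%:E < +oo -> X \in Lfun P 2%:E.
Proof.
move=> mX X2; rewrite inE; apply/andP; split; rewrite inE//=.
rewrite /finite_norm unlock poweR_lty//; apply: le_lt_trans X2.
rewrite le_eqVlt; apply/orP; left; apply/eqP/eq_integral => w _.
by rewrite /= powR_mulrn// real_normK ?num_real.
Qed.

Lemma variance_integral (X : T -> R) :
  'V_P[X] = \int[P]_w ((X w - mean P X) ^+ 2)%:E.
Proof. by rewrite /variance unlock expectation_integral. Qed.

(** Finite variance bounds the second moment of [X - m]; this puts [X - m], hence [X], in L2, where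
    the usual formula for the variance is available. *)
Lemma sqr_integral_var (X : T -> R) (m : R) : measurable_fun setT X ->
  'E_P[X] = m%:E -> 'V_P[X] < +oo ->
  \int[P]_w (X w ^+ 2)%:E = (var P X + m ^+ 2)%:E.
Proof.
move=> mX Xm Voo.
have XmL : (X \- cst m)%R \in Lfun P 2%:E.
  apply: sqr_integrable_Lfun2; first exact: measurable_funB.
  by move: Voo; rewrite variance_integral /mean Xm.
have XL : X \in Lfun P 2%:E.
  rewrite (_ : X = (X \- cst m) + cst m)%R; last first.
    by apply/funext => w; rewrite fctE /= subrK.
  by apply: rpredD => //; [rewrite lee1n|move=> ?; exact: Lfun_cst].
have := varianceE XL; rewrite Xm => VE.
have V2 : 'V_P[X] = (var P X)%:E by rewrite /var fineK// variance_fin_num.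
rewrite V2 in VE; rewrite EFinD VE -EFin_expe subeK//.
by rewrite expectation_integral.
Qed.

Lemma variance_sqr_integral (X : T -> R) (m q : R) : measurable_fun setT X ->
  'E_P[X] = m%:E -> \int[P]_w (X w ^+ 2)%:E = q%:E ->
  'V_P[X] = (q - m ^+ 2)%:E.
Proof.
move=> mX Xm Xq; rewrite varianceE; last first.
  by apply: sqr_integrable_Lfun2 => //; rewrite Xq ltry.
by rewrite Xm expectation_integral Xq -EFin_expe.
Qed.

End first_two_moments.

Section claim_moments.
Context {disp : measure_display} {T : measurableType disp} {R : realType}.
Variables (P : probability T R) (d : nat) (M : group_claims_model P d).
Hypothesis d_gt0 : (0 < d)%N.
Local Open Scope ereal_scope.

Local Notation K := (total_rate M * (1 - p0 M))%R.

Lemma measurable_natrv s : measurable_fun setT (natrv (Utilde1 M s) : T -> R).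
Proof. by apply: (@measurableT_comp _ _ _ _ _ _ (fun n : nat => n%:R : R)). Qed.

Lemma integral_claim_expR (z : R) (a : 'I_d -> R) :
  (forall s, \int[P]_w (expR (z * Ytilde11 M s w))%:E = (a s)%:E) ->
  (forall s, pgf P (Utilde1 M s) (a s) < +oo) ->
  \int[P]_w (expR (z * claim M 0%N w))%:E =
  ((\sum_(s < d) rate M s / total_rate M * fine (pgf P (Utilde1 M s) (a s)) -
    p0 M) / (1 - p0 M))%:E.
Proof.
move=> Ya Ua.
have a0 s : (0 <= a s)%R.
  by rewrite -lee_fin -Ya; apply: integral_ge0 => w _; rewrite lee_fin expR_ge0.
rewrite (integral_claim_eq (f := fun x => (expR (z * x))%:E) 0%N (a := 1%R)
  (b := fun s => fine (pgf P (Utilde1 M s) (a s)))).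
- by rewrite mulr1.
- by apply/measurable_EFinP; exact: measurableT_comp.
- by move=> x; rewrite lee_fin expR_ge0.
- by rewrite mulr0 expR0.
move=> s; rewrite fineK.
  rewrite /pgf expectation_integral; apply: eq_integral => w _.
  by apply: integral_expR_psum; [exact: typed_claims_iid|exact: Ya].
rewrite ge0_fin_numE// /pgf expectation_integral; apply: integral_ge0 => w _.
by rewrite lee_fin exprn_ge0.
Qed.

(** The closed form is that of [integral_claim_expR], so the transform of a claim and the joint
    generating function are compared through it. *)
Lemma joint_pgf_Uvec (a : 'I_d -> R) : (forall s, 0 <= a s)%R ->
  (forall s, pgf P (Utilde1 M s) (a s) < +oo) ->
  joint_pgf P (fun s => Uvec M 0%N s : T -> nat) a =
  ((\sum_(s < d) rate M s / total_rate M * fine (pgf P (Utilde1 M s) (a s)) -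
    p0 M) / (1 - p0 M))%:E.
Proof.
move=> a0 Ua; apply: thinning_solve.
pose g (t : d.-tuple nat) : \bar R := (\prod_(s < d) a s ^+ tnth t s)%:E.
have g0 t : 0 <= g t by rewrite lee_fin prodr_ge0// => s _; rewrite exprn_ge0.
have := integral_Uvec M 0%N g0.
have -> : g [tuple 0%N | s < d] = 1.
  by rewrite /g big1// => s _; rewrite tnth_mktuple.
rewrite mule1 -sumEFin => E; rewrite /joint_pgf expectation_integral.
rewrite (eq_integral (g \o vec_rv (Uvec M 0%N))); last first.
  move=> w _; congr EFin; apply: eq_bigr => s _.
  by rewrite tnth_mktuple.
rewrite E; apply: eq_bigr => s _; rewrite [RHS]EFinM; congr (_ * _).
rewrite fineK; last first.
  rewrite ge0_fin_numE// /pgf expectation_integral; apply: integral_ge0 => w _.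
  by rewrite lee_fin exprn_ge0.
rewrite /pgf expectation_integral; apply: eq_integral => w _; congr EFin.
rewrite (bigD1 s)//= tnth_mktuple eqxx big1 ?mulr1// => r rs.
by rewrite tnth_mktuple (negbTE rs).
Qed.

Hypothesis EY_fin : forall s, 'E_P[Ytilde11 M s] < +oo.
Hypothesis EU_fin : forall s, 'E_P[natrv (Utilde1 M s)] < +oo.

Lemma Ytilde11_ge0 s : {ae P, forall w, (0 <= Ytilde11 M s w)%R}.
Proof. by apply: filterS (@Ytilde_positive _ _ _ _ _ M 0%N 0%N s) => w /ltW. Qed.

Lemma integral_norm_Ytilde s :
  \int[P]_w (`|Ytilde11 M s w|)%:E = (mean P (Ytilde11 M s))%:E.
Proof.
have Y0 := Ytilde11_ge0 s.
by rewrite -ge0_meanE// ge0_expectation.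
Qed.

Lemma integral_Utilde s :
  \int[P]_w ((Utilde1 M s w)%:R%:E) = (mean P (natrv (Utilde1 M s)))%:E :> \bar R.
Proof.
rewrite -ge0_meanE; [by rewrite expectation_integral|exact: measurable_natrv|
  by apply: aeW => w; rewrite ler0n|exact: EU_fin].
Qed.

Lemma integral_norm_claim i :
  \int[P]_w (`|claim M i w|)%:E =
  (\sum_(s < d) rate M s * mean P (natrv (Utilde1 M s)) / K *
     mean P (Ytilde11 M s))%:E.
Proof.
rewrite (integral_claim_eq (f := fun x => `|x|%:E) i (a := 0%R)
  (b := fun s => mean P (natrv (Utilde1 M s)) * mean P (Ytilde11 M s))%R).
- congr EFin; rewrite mulr0 subr0 mulr_suml; apply: eq_bigr => s _.
  rewrite invfM; ring.
- by apply/measurable_EFinP; exact: normr_measurable.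
- by move=> x; rewrite lee_fin.
- by rewrite normr0.
move=> s; rewrite EFinM -integral_Utilde -ge0_integralZr//.
- apply: eq_integral => w _; rewrite -EFinM.
  apply: integral_norm_psum; first exact: typed_claims_iid.
    by move=> j; exact: Ytilde_positive.
  exact: integral_norm_Ytilde.
- by apply/measurable_EFinP; exact: measurable_natrv.
- by rewrite -integral_norm_Ytilde; apply: integral_ge0.
Qed.

Lemma expectation_claim i :
  'E_P[claim M i] =
  (\sum_(s < d) rate M s * mean P (natrv (Utilde1 M s)) / K *
     mean P (Ytilde11 M s))%:E.
Proof.
rewrite ge0_expectation ?integral_norm_claim//.
by apply: filterS (claim_gt0 M i) => w /ltW.
Qed.

Hypothesis VY_fin : forall s, 'V_P[Ytilde11 M s] < +oo.
Hypothesis VU_fin : forall s, 'V_P[natrv (Utilde1 M s)] < +oo.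

Lemma variance_claim :
  'V_P[claim M 0%N] =
   (\sum_(s < d) rate M s *
      (var P (natrv (Utilde1 M s)) * mean P (Ytilde11 M s) ^+ 2 +
       mean P (natrv (Utilde1 M s)) ^+ 2 * mean P (Ytilde11 M s) ^+ 2 +
       mean P (natrv (Utilde1 M s)) * var P (Ytilde11 M s)) / K -
    (\sum_(s < d) rate M s * mean P (natrv (Utilde1 M s)) *
       mean P (Ytilde11 M s) / K) ^+ 2)%:E.
Proof.
pose EU s := mean P (natrv (Utilde1 M s)); pose EY s := mean P (Ytilde11 M s).
pose VU s := var P (natrv (Utilde1 M s)); pose VY s := var P (Ytilde11 M s).
have VY0 s : (0 <= VY s)%R by rewrite fine_ge0// variance_ge0.
(* Second moment of a random sum: with [q = VY + EY ^+ 2], the value [k q + (k ^+ 2 - k) EY ^+ 2] is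
   [k VY + k ^+ 2 EY ^+ 2], averaged over the number of claims. *)
pose b s := (EU s * VY s + (VU s + EU s ^+ 2) * EY s ^+ 2)%R.
have sqrU s : \int[P]_w ((Utilde1 M s w)%:R ^+ 2)%:E = (VU s + EU s ^+ 2)%:E.
  apply: (@sqr_integral_var _ _ _ _ (natrv (Utilde1 M s))) => //.
    exact: measurable_natrv.
  by rewrite expectation_integral integral_Utilde.
have sqrY s : \int[P]_w (Ytilde11 M s w ^+ 2)%:E = (VY s + EY s ^+ 2)%:E.
  apply: sqr_integral_var => //.
  by apply: ge0_meanE => //; exact: Ytilde11_ge0.
have sqrC : \int[P]_w (claim M 0%N w ^+ 2)%:E =
    ((\sum_(s < d) rate M s / total_rate M * b s - p0 M * 0) / (1 - p0 M))%:E.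
  apply: (integral_claim_eq (f := fun x => (x ^+ 2)%:E) 0%N (a := 0%R) (b := b)).
  - by apply/measurable_EFinP; exact: measurable_funX.
  - by move=> x; rewrite lee_fin sqr_ge0.
  - by rewrite expr0n.
  move=> s.
  have mU : measurable_fun setT (fun w => (Utilde1 M s w)%:R%:E : \bar R).
    by apply/measurable_EFinP; exact: measurable_natrv.
  have mU2 : measurable_fun setT (fun w => ((Utilde1 M s w)%:R ^+ 2)%:E : \bar R).
    by apply/measurable_EFinP; apply: measurable_funX; exact: measurable_natrv.
  transitivity (\int[P]_w ((Utilde1 M s w)%:R%:E * (VY s)%:E +
      ((Utilde1 M s w)%:R ^+ 2)%:E * (EY s ^+ 2)%:E)).
    apply: eq_integral => w _.
    rewrite (@integral_sqr_psum _ _ _ _ (typed_claims M 0%N s) _ _ (EY s)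
      (VY s + EY s ^+ 2)%R).
    - by rewrite -!EFinM -EFinD; congr EFin; ring.
    - exact: typed_claims_iid.
    - by move=> j; exact: Ytilde_positive.
    - exact: integral_norm_Ytilde.
    - exact: sqrY.
  rewrite ge0_integralD//; last 4 first.
  - by move=> w _; rewrite mule_ge0// lee_fin.
  - by apply: emeasurable_funM.
  - by move=> w _; rewrite mule_ge0// lee_fin sqr_ge0.
  - by apply: emeasurable_funM.
  rewrite ge0_integralZr//; last by rewrite lee_fin; exact: VY0.
  rewrite ge0_integralZr//; last by rewrite lee_fin sqr_ge0.
  by rewrite sqrU integral_Utilde -!EFinM -EFinD.
rewrite (variance_sqr_integral _ (expectation_claim 0%N) sqrC)//; congr EFin.
rewrite mulr0 subr0 mulr_suml; congr (_ - _ ^+ 2)%R.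
  by apply: eq_bigr => s _; rewrite /b /EU /EY /VU /VY invfM; ring.
by apply: eq_bigr => s _; rewrite mulrAC.
Qed.

(** The two terms in the squared means merge, since 1/(1-p) - 1/(1-p)^2 = -p/(1-p)^2. *)
Lemma variance_claim_single_type s : d = 1%N ->
  'V_P[claim M 0%N] =
    ((var P (natrv (Utilde1 M s)) * mean P (Ytilde11 M s) ^+ 2 +
      mean P (natrv (Utilde1 M s)) * var P (Ytilde11 M s)) / (1 - p0 M) -
     p0 M * mean P (natrv (Utilde1 M s)) ^+ 2 *
       mean P (Ytilde11 M s) ^+ 2 / (1 - p0 M) ^+ 2)%:E.
Proof.
move=> d1.
have sum1 (F : 'I_d -> R) : (\sum_(r < d) F r = F s)%R.
  rewrite (bigD1 s)//= big1 ?addr0// => r /eqP[]; apply: val_inj.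
  have lt1 (t : 'I_d) : (t < 1)%N := leq_trans (ltn_ord t) (eq_leq d1).
  have := lt1 r; have := lt1 s; rewrite !ltnS !leqn0 => /eqP s0 /eqP r0.
  exact: etrans r0 (esym s0).
rewrite variance_claim !sum1; congr EFin.
rewrite (_ : total_rate M = rate M s); last exact: sum1.
field; rewrite !gt_eqF ?rate_gt0//.
by rewrite subr_gt0 p0_lt1.
Qed.

End claim_moments.

(** * Distribution function of a claim as a series of convolutions *)

Section claim_cdf.
Context {disp : measure_display} {T : measurableType disp} {R : realType}.
Variables (P : probability T R) (d : nat) (M : group_claims_model P d).
Hypothesis d_gt0 : (0 < d)%N.
Local Open Scope ereal_scope.

Local Notation K := (total_rate M * (1 - p0 M))%R.

Lemma endpoints_support (U : T -> nat) j : (0 < pr_eq P U j)%R ->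
  lower_end P U <= j%:R%:E <= upper_end P U.
Proof.
move=> Uj; apply/andP; split.
  by apply: ereal_inf_lbound; exists j.
by apply: ereal_sup_ubound; exists j.
Qed.

(** An index outside the end points has probability 0, so the restricted series equals the full
    one. *)
Lemma series_endpoints (U : {RV P >-> nat}) (h : nat -> \bar R) (a c : R) :
  (0 <= a)%R -> (0 <= c)%R -> (forall j, 0 <= h j) ->
  \sum_(0 <= j <oo | lower_end P U <= j%:R%:E <= upper_end P U)
     h j * (a * pr_eq P U j / c)%:E =
  (a / c)%:E * \int[P]_w h (U w).
Proof.
move=> a0 c0 h0; rewrite integral_nat_rv// -nneseriesZl; last first.
  by move=> j _; rewrite mule_ge0// lee_fin fine_ge0.
rewrite eseries_mkcond; apply: eq_eseriesr => j _.
have -> : (a * pr_eq P U j / c = a / c * pr_eq P U j)%R by rewrite mulrAC.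
case: ifPn => [_|]; first by rewrite EFinM muleCA.
have : (0 <= pr_eq P U j)%R by rewrite fine_ge0.
rewrite le_eqVlt => /predU1P[<- _|/endpoints_support -> //].
by rewrite !mule0.
Qed.

(** Serves both the c.d.f. and its complement: the correction [p0 / (1 - p0)] is present exactly
    when [A] contains 0. *)
Lemma claim_probability_series (A : set R) : measurable A ->
  P (claim M 0%N @^-1` A) =
  \sum_(s < d)
    \sum_(0 <= j <oo | lower_end P (Utilde1 M s) <= j%:R%:E
                         <= upper_end P (Utilde1 M s))
      P (psum (typed_claims M 0%N s) j @^-1` A) *
      (rate M s * pr_eq P (Utilde1 M s) j / K)%:E -
  (p0 M * \1_A 0 / (1 - p0 M))%:E.
Proof.
move=> mA.
have p1 : (0 < 1 - p0 M)%R by rewrite subr_gt0 p0_lt1.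
have K0 : (0 < K)%R by rewrite mulr_gt0// total_rate_gt0.
pose h s j := P (psum (typed_claims M 0%N s) j @^-1` A).
have mX j s : measurable (psum (typed_claims M 0%N s) j @^-1` A).
  exact: measurable_funPTI.
have hfin s : \int[P]_w h s (Utilde1 M s w) \is a fin_num.
  rewrite ge0_fin_numE; last by apply: integral_ge0.
  apply: (@le_lt_trans _ _ 1); last exact: ltry.
  rewrite -[leRHS](integral_cst_probability P); apply: ge0_le_integral => //.
  - by apply: (@measurableT_comp _ _ _ _ _ _ (h s)).
  - by move=> w _; exact: probability_le1.
have int_indic s j : \int[P]_w (\1_A (psum (typed_claims M 0%N s) j w))%:E = h s j.
  exact: integral_indic_preimage.
rewrite -integral_indic_preimage//.
rewrite (integral_claim_eq (f := fun x => (\1_A x)%:E) 0%N (a := \1_A 0%R)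
  (b := fun s => fine (\int[P]_w h s (Utilde1 M s w)))).
- under [in RHS]eq_bigr => s _.
    rewrite (series_endpoints (Utilde1 M s) _ (ltW K0) (h := h s))//; last first.
      by rewrite ltW// rate_gt0.
    rewrite -[X in _ * X]fineK// -EFinM; over.
  rewrite sumEFin -EFinB mulrBl mulr_suml; congr (_ - _)%:E.
  by apply: eq_bigr => s _; rewrite invfM; ring.
- exact: measurable_indic_ereal.
- by move=> x; rewrite lee_fin.
- by [].
move=> s; rewrite fineK//.
by apply: eq_integral => w _; rewrite int_indic.
Qed.

Lemma cdf_claim (x : R) : (0 <= x)%R ->
  cdf (claim M 0%N) x =
  \sum_(s < d)
    \sum_(0 <= j <oo | lower_end P (Utilde1 M s) <= j%:R%:E
                         <= upper_end P (Utilde1 M s))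
      conv_pow (Ytilde11 M s) j x *
      (rate M s * pr_eq P (Utilde1 M s) j / K)%:E -
  (p0 M / (1 - p0 M))%:E.
Proof.
move=> x0; rewrite -[LHS]/(P (claim M 0%N @^-1` `]-oo, x]%classic)).
rewrite claim_probability_series; last exact: measurable_itv.
rewrite indicE mem_set/= ?in_itv//= mulr1; congr (_ + _).
apply: eq_bigr => s _; apply: eq_eseriesr => j _; congr (_ * _).
by rewrite (conv_pow_psum (typed_claims_iid M 0%N s)).
Qed.

Lemma ccdf_claim (x : R) : (0 <= x)%R ->
  1 - cdf (claim M 0%N) x =
  \sum_(s < d)
    \sum_(0 <= j <oo | lower_end P (Utilde1 M s) <= j%:R%:E
                         <= upper_end P (Utilde1 M s))
      (1 - conv_pow (Ytilde11 M s) j x) *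
      (rate M s * pr_eq P (Utilde1 M s) j / K)%:E.
Proof.
move=> x0; rewrite -ccdf_1_cdf.
rewrite -[LHS]/(P (claim M 0%N @^-1` `]x, +oo[%classic)).
rewrite claim_probability_series; last exact: measurable_itv.
rewrite indicE memNset/= ?in_itv/= ?andbT ?ltNge ?x0// mulr0 mul0r sube0.
apply: eq_bigr => s _; apply: eq_eseriesr => j _; congr (_ * _).
rewrite (conv_pow_psum (typed_claims_iid M 0%N s)).
set X := psum _ _.
have mX : measurable (X @^-1` `]-oo, x]) by exact: measurable_funPTI.
have -> : [set w | (X w <= x)%R] = X @^-1` `]-oo, x].
  by apply/seteqP; split=> w; rewrite /preimage /= in_itv.
have <- : P (~` (X @^-1` `]-oo, x])) = 1 - P (X @^-1` `]-oo, x]).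
  exact: probability_setC.
by rewrite preimage_setC setCitvl.
Qed.

End claim_cdf.

(** * The integrated tail distribution *)

Lemma ge0_integral_mrestr {d : measure_display} {T : measurableType d}
    {R : realType} (m : {measure set T -> \bar R}) (D : set T)
    (mD : measurable D) (f : T -> \bar R) :
  measurable_fun setT f -> (forall x, (0 <= f x)%E) ->
  (\int[mrestr m mD]_x f x = \int[m]_(x in D) f x)%E.
Proof.
move=> mf f0; rewrite -(setUv D) ge0_integral_setU ?setUv//; last 2 first.
- exact: measurableC.
- by apply/disj_set2P; rewrite setICr.
rewrite [X in (_ + X)%E]null_set_integral ?adde0; last 3 first.
- exact: measurableC.
- exact: measurable_funTS.
- by rewrite -[LHS]/(m (~` D `&` D)) setICl measure0.
by apply: eq_measure_integral => A mA AD; rewrite -[LHS]/(m (A `&` D)) setIidl.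
Qed.

Section integrated_tail.
Context {disp : measure_display} {T : measurableType disp} {R : realType}.
Variables (P : probability T R) (X : {RV P >-> R}).
Local Open Scope ereal_scope.

Local Notation GR := (measurableTypeR R).
Local Notation leb := (@lebesgue_measure R).

Definition undergraph : set (GR * T) :=
  [set z | (0 <= (z.1 : R))%R /\ ((z.1 : R) < X z.2)%R].

Lemma measurable_undergraph : measurable undergraph.
Proof.
rewrite (_ : undergraph = (fst @^-1` (`[0%R, +oo[ : set R)) `&`
    (fun z => X z.2 - (z.1 : R))%R @^-1` (`]0%R, +oo[ : set R)); last first.
  apply/seteqP; split=> -[y w] /=; rewrite !in_itv/= !andbT subr_gt0.
    by case.
  by case.
apply: measurableI.
  rewrite -[X in measurable X]setTI; exact: (@measurable_fst _ _ GR T).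
rewrite -[X in measurable X]setTI.
have mf : measurable_fun [set: (GR * T)%type] (fun z => X z.2 - (z.1 : R))%R.
  by apply: measurable_funB; [exact: measurableT_comp|exact: (@measurable_fst _ _ GR T)].
exact: mf.
Qed.

Lemma undergraph_indic w (y : R) : \1_undergraph (y, w) = \1_`[0%R, X w[ y :> R.
Proof.
rewrite !indicE; congr (nat_of_bool _)%:R; apply/idP/idP.
  by rewrite !inE /= in_itv/= => -[-> ->].
by rewrite !inE /= in_itv/= => /andP[].
Qed.

(** For a fixed outcome [w] the section of the undergraph is [[0, X w[]; this order of integration
    gives the transform. *)
Lemma integral_undergraph1 (f : R -> \bar R) :
  measurable_fun setT f -> (forall x, 0 <= f x) ->
  \int[leb \x P]_(z in undergraph) f z.1 =
  \int[P]_w \int[leb]_(y in `[0%R, X w[) f y.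
Proof.
move=> mf f0; have mD := measurable_undergraph.
rewrite integral_mkcond epatch_indic.
pose g (z : (GR * T)%type) := f z.1 * (\1_undergraph z)%:E.
have mfD : measurable_fun [set: (GR * T)%type] g.
  apply: emeasurable_funM.
    apply: (@measurableT_comp _ _ _ _ _ _ f) => //; exact: (@measurable_fst _ _ GR T).
  by apply/measurable_EFinP; exact: measurable_indic.
rewrite (fubini_tonelli1 _ mfD); last by move=> z; rewrite mule_ge0// lee_fin.
apply: etrans.
  by apply: (fubini_tonelli g mfD) => z; rewrite mule_ge0// lee_fin.
apply: eq_integral => w _; rewrite /fubini_G [RHS]integral_mkcond epatch_indic.
by apply: eq_integral => y _; rewrite /g /= undergraph_indic.
Qed.

(** For a fixed level [y >= 0] the section is the event [X > y]; this order gives the integrated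
    tail. *)
Lemma integral_undergraph2 (f : R -> \bar R) :
  measurable_fun setT f -> (forall x, 0 <= f x) ->
  \int[leb \x P]_(z in undergraph) f z.1 =
  \int[leb]_(y in `[0%R, +oo[) (f y * ccdf X y).
Proof.
move=> mf f0; have mD := measurable_undergraph.
rewrite integral_mkcond epatch_indic.
pose g (z : (GR * T)%type) := f z.1 * (\1_undergraph z)%:E.
have mfD : measurable_fun [set: (GR * T)%type] g.
  apply: emeasurable_funM.
    apply: (@measurableT_comp _ _ _ _ _ _ f) => //; exact: (@measurable_fst _ _ GR T).
  by apply/measurable_EFinP; exact: measurable_indic.
rewrite (fubini_tonelli1 _ mfD); last by move=> z; rewrite mule_ge0// lee_fin.
rewrite [RHS]integral_mkcond epatch_indic.
apply: eq_integral => y _; rewrite /fubini_F /g /=.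
pose B : set T := X @^-1` (`]y, +oo[ : set R).
have mB : measurable B by exact: measurable_funPTI.
have E w : \1_undergraph (y, w) = (\1_(`[0%R, +oo[ : set R) y * \1_B w)%R :> R.
  rewrite !indicE -natrM mulnb; congr (nat_of_bool _)%:R; apply/idP/andP.
    by rewrite !inE /B /= !in_itv/= !andbT => -[y0 yX]; split.
  by rewrite !inE /B /= !in_itv/= !andbT => -[y0 yX]; split.
under eq_integral do rewrite E EFinM muleA.
rewrite ge0_integralZl//; last 2 first.
- by apply/measurable_EFinP; exact: measurable_indic.
- by rewrite mule_ge0// lee_fin.
by rewrite integral_indic// setIT muleAC.
Qed.

Hypothesis X_ge0 : {ae P, forall w, (0 <= X w)%R}.

(** The maximum accounts for negative [x], where the interval is empty; [X] is nonnegative only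
    almost surely. *)
Lemma integral_itv0co_cst1 (x : R) :
  \int[leb]_(y in `[0%R, x[) cst 1 y = (Num.max x 0)%:E.
Proof.
rewrite integral_cst// mul1e.
transitivity (leb `[0%R, x[); first by [].
rewrite lebesgue_measure_itv/= lte_fin; case: ltP => x0.
  by rewrite -EFinB subr0; congr EFin; apply/esym/max_idPl/ltW.
by congr EFin; apply/esym/max_idPr.
Qed.

Lemma integral_expR_itv0co (z x : R) : (0 < z)%R ->
  \int[leb]_(y in `[0%R, x[) (expR (- (z * y)))%:E =
  ((1 - expR (- (z * Num.max x 0))) / z)%:E.
Proof.
move=> z0; have [x0|x0] := leP x 0%R.
  rewrite set_itv_ge ?bnd_simp -?leNgt// integral_set0.
  by rewrite mulr0 oppr0 expR0 subrr mul0r.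
have mf : measurable_fun setT (fun y : R => (expR (- (z * y)))%:E : \bar R).
  apply/measurable_EFinP; apply: measurableT_comp => //.
  by apply: measurableT_comp.
rewrite integral_itv_bndo_bndc; last exact: measurable_funTS.
(* The integrand is [z^-1] times the exponential density of rate [z], whose mass on [[0, x]] is
   known. *)
have := exponential_prob_itv0c z x0; rewrite /exponential_prob => E.
have z1 : (z^-1 * z = 1)%R by rewrite mulVf// gt_eqF.
transitivity ((z^-1)%:E * \int[leb]_(y in `[0%R, x]) (exponential_pdf z y)%:E).
  rewrite -ge0_integralZl//; last 3 first.
  - apply/measurable_EFinP; apply: measurable_funTS.
    exact: measurable_exponential_pdf.
  - by move=> y _; rewrite lee_fin exponential_pdf_ge0// ltW.
  - by rewrite lee_fin invr_ge0 ltW.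
  apply: eq_integral => y; rewrite inE/= in_itv/= => /andP[y0 _].
  by rewrite exponential_pdfE// -EFinM mulrA z1 mul1r mulNr.
by rewrite E -EFinB -EFinM mulrC mulNr.
Qed.

Variable m : R.
Hypothesis m_gt0 : (0 < m)%R.
Hypothesis X_mean : \int[P]_w (`|X w|)%:E = m%:E.

(* The law whose c.d.f. is the integrated tail of [X]: its density is P(X > y) / m. *)
Definition residual_life (A : set GR) : \bar R :=
  (m^-1)%:E * (leb \x P) ((fst : GR * T -> GR) @^-1` A `&` undergraph).

Let minv_ge0 : (0 <= m^-1)%R. Proof. by rewrite invr_ge0 ltW. Qed.

(** The same set function composed from measure constructions, from which [residual_life] takes its
    measure axioms. *)
Let scaled_law : {measure set GR -> \bar R}.
Proof.
refine (mscale (NngNum minv_ge0)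
  (pushforward (mrestr (leb \x P) measurable_undergraph) (fst : GR * T -> GR))).
exact: (@measurable_fst _ _ GR T).
Defined.

Let residual_life0 : residual_life set0 = 0.
Proof. exact: (measure0 scaled_law). Qed.

Let residual_life_ge0 A : 0 <= residual_life A.
Proof. exact: (measure_ge0 scaled_law). Qed.

Let residual_life_sigma_additive : semi_sigma_additive residual_life.
Proof. exact: (@measure_semi_sigma_additive _ _ _ scaled_law). Qed.

HB.instance Definition _ := isMeasure.Build _ _ _ residual_life
  residual_life0 residual_life_ge0 residual_life_sigma_additive.

Lemma integral_residual_life (f : R -> \bar R) :
  measurable_fun setT f -> (forall x, 0 <= f x) ->
  \int[residual_life]_x f x =
  (m^-1)%:E * \int[leb \x P]_(z in undergraph) f z.1.
Proof.
move=> mf f0.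
rewrite -(ge0_integral_mrestr _ measurable_undergraph); last 2 first.
- by apply: (@measurableT_comp _ _ _ _ _ _ f) => //; exact: (@measurable_fst _ _ GR T).
- by move=> z; exact: f0.
rewrite -(@ge0_integral_pushforward _ _ _ _ _ (fst : GR * T -> GR) measurable_fst
  (mrestr (leb \x P) measurable_undergraph) setT f)//.
rewrite -[X in X%:E * _]/((NngNum minv_ge0)%:num)%R.
by rewrite -(ge0_integral_mscale _ measurableT (NngNum minv_ge0)).
Qed.

Lemma integral_residual_life_tail (f : R -> \bar R) :
  measurable_fun setT f -> (forall x, 0 <= f x) ->
  \int[residual_life]_x f x =
  (m^-1)%:E * \int[leb]_(y in `[0%R, +oo[) (f y * ccdf X y).
Proof. by move=> mf f0; rewrite integral_residual_life// integral_undergraph2. Qed.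

Lemma integral_residual_life_section (f : R -> \bar R) :
  measurable_fun setT f -> (forall x, 0 <= f x) ->
  \int[residual_life]_x f x =
  (m^-1)%:E * \int[P]_w \int[leb]_(y in `[0%R, X w[) f y.
Proof. by move=> mf f0; rewrite integral_residual_life// integral_undergraph1. Qed.

Let residual_life_setT : residual_life setT = 1.
Proof.
have <- : \int[residual_life]_x cst 1 x = residual_life setT.
  by rewrite integral_cst// mul1e.
rewrite integral_residual_life_section//.
have -> : \int[P]_w \int[leb]_(y in `[0%R, X w[) cst 1 y = m%:E.
  rewrite -X_mean; apply: ae_eq_integral => //.
  - under eq_fun do rewrite integral_itv0co_cst1.
    by apply/measurable_EFinP; apply: measurable_maxr.
  - by apply/measurable_EFinP; exact: measurableT_comp.
  - apply: filterS X_ge0 => w X0 _ /=.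
    rewrite integral_itv0co_cst1 ger0_norm//.
    by congr EFin; apply/max_idPl.
by rewrite -EFinM mulVf// gt_eqF.
Qed.

HB.instance Definition _ := Measure_isProbability.Build _ _ _
  residual_life residual_life_setT.

Let idGR : GR -> R := idfun.

#[local] HB.instance Definition _ :=
  @isMeasurableFun.Build _ _ _ _ idGR (@measurable_id _ _ setT).

Let F (x : R) : R := fine (cdf (idGR : {RV residual_life >-> R}) x).

Let F_nondecreasing : nondecreasing F.
Proof. by move=> x y xy; rewrite fine_le ?fin_num_measure// cdf_nondecreasing. Qed.

Let F_right_continuous : right_continuous F.
Proof.
move=> x; apply: fine_cvg.
by rewrite fineK ?fin_num_measure//; exact: cdf_right_continuous.
Qed.

#[local] HB.instance Definition _ :=
  isCumulative.Build R _ R F F_nondecreasing F_right_continuous.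

Let F_Ny : (F @ -oo --> (0 : R))%R.
Proof. exact/fine_cvg/cvg_cdfNy0. Qed.

Let F_y : (F @ +oo --> (1 : R))%R.
Proof. exact/fine_cvg/cvg_cdfy1. Qed.

#[local] HB.instance Definition _ :=
  isCumulativeBounded.Build R 0%R 1%R F F_Ny F_y.

Let FE x : F x = (m^-1 * fine (\int[leb]_(y in `[0%R, x]) (1 - cdf X y)))%R.
Proof.
have mf : measurable_fun setT (fun y : R => (\1_(`]-oo, x] : set R) y)%:E : \bar R).
  by apply/measurable_EFinP; exact: measurable_indic.
have -> : F x = fine (\int[residual_life]_y (\1_(`]-oo, x] : set R) y)%:E).
  by rewrite integral_indic// setIT.
rewrite integral_residual_life_tail//.
have -> : \int[leb]_(y in `[0%R, +oo[) ((\1_(`]-oo, x] : set R) y)%:E * ccdf X y) =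
    \int[leb]_(y in `[0%R, x]) (1 - cdf X y).
  rewrite integral_mkcond [RHS]integral_mkcond; apply: eq_integral => y _.
  rewrite !patchE !mem_setE !in_itv/= andbT; case: (leP 0%R y) => y0 //=.
  rewrite indicE mem_setE in_itv/= -ccdf_1_cdf.
  by case: (leP y x) => _; rewrite ?mul1e// mul0e.
(* The integral is not yet known to be finite; in the infinite cases [fine] returns 0 on both
   sides. *)
have minv_gt0 : 0 < (m^-1)%:E by rewrite lte_fin invr_gt0.
case: (\int[leb]_(y in `[0%R, x]) (1 - cdf X y)) => [r| |] //=.
- by rewrite gt0_muley//= mulr0.
- by rewrite gt0_muleNy//= mulr0.
Qed.

(** Both measures agree on half-open intervals, and uniqueness extends this to measurable sets. *)
Let stieltjes_F A : measurable A ->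
  lebesgue_stieltjes_measure F A = residual_life A.
Proof.
move=> mA; apply: lebesgue_stieltjes_measure_unique => [I [[a b]]/= _ <- | //].
rewrite /lebesgue_stieltjes_measure /measure_extension/=.
rewrite measurable_mu_extE/=; last exact: is_ocitv.
have [ab | ba] := leP a b; last first.
  by rewrite set_itv_ge ?wlength0 ?measure0// bnd_simp -leNgt ltW.
rewrite wlength_itv_bnd// EFinB !fineK ?fin_num_measure//.
rewrite /cdf /distribution /pushforward !preimage_id.
have : `]a, b]%classic = `]-oo, b] `\` `]-oo, a] => [|->].
  by rewrite -[RHS]setCK setCD setCitvl setUC -[LHS]setCK setCitv.
rewrite measureD ?setIidr//; first exact: subset_itvl.
by rewrite -ge0_fin_numE// fin_num_measure.
Qed.

Lemma integrated_tail_transform :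
  exists G : cumulativeBounded (0 : R) (1 : R),
    (forall x, G x = m^-1 * fine (\int[leb]_(y in `[0%R, x]) (1 - cdf X y)))%R /\
    (forall z l : R, (0 < z)%R -> \int[P]_w (expR (- (z * X w)))%:E = l%:E ->
      lst_cdf G z = ((1 - l) / (z * m))%:E).
Proof.
exists F; split=> [x|z l z0 lE]; first exact: FE.
rewrite /lst_cdf.
rewrite (eq_measure_integral residual_life); last by move=> A mA _; exact: stieltjes_F.
have mf : measurable_fun setT (fun y : R => (expR (- (z * y)))%:E : \bar R).
  apply/measurable_EFinP; apply: measurableT_comp => //.
  exact: measurableT_comp.
rewrite integral_mkcond integral_residual_life_section; last 2 first.
- by apply/(measurable_restrictT _ _).1 => //; exact: measurable_funTS.
- by move=> x; apply: erestrict_ge0 => y _; rewrite lee_fin expR_ge0.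
(* Truncating at 0 makes [e] bounded by 1 everywhere, while it agrees almost surely with the
   integrand of the transform of [X]. *)
pose e w : R := expR (- (z * Num.max (X w) 0))%R.
have me : measurable_fun setT e.
  apply: measurableT_comp => //; apply: measurableT_comp => //.
  by apply: measurableT_comp => //; exact: measurable_maxr.
have e1 w : (e w <= 1)%R.
  by rewrite /e -expR0 ler_expR oppr_le0; apply: mulr_ge0;
    [exact: ltW|rewrite le_max lexx orbT].
have inner w : \int[leb]_(y in `[0%R, X w[)
    ((fun y : R => (expR (- (z * y)))%:E) \_ `[0%R, +oo[) y = ((1 - e w) / z)%:E.
  rewrite /e -integral_expR_itv0co//; apply: eq_integral => y.
  by rewrite inE/= in_itv/= => /andP[y0 _]; rewrite patchE mem_setE in_itv/= y0.
under eq_integral do rewrite inner.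
have el : \int[P]_w (e w)%:E = l%:E.
  rewrite -lE; apply: ae_eq_integral => //.
  - exact/measurable_EFinP.
  - by apply: (measurableT_comp mf).
  - by apply: filterS X_ge0 => w X0 _; rewrite /e; do 4 congr (_ _); apply/max_idPl.
(* Stated as a sum so that additivity for nonnegative functions suffices; the finite term is
   subtracted afterwards. *)
have J0 : \int[P]_w ((1 - e w) / z)%:E + (l / z)%:E = (z^-1)%:E.
  rewrite mulrC EFinM -el -ge0_integralZl//; last 3 first.
  - exact/measurable_EFinP.
  - by move=> w _; rewrite lee_fin expR_ge0.
  - by rewrite lee_fin invr_ge0 ltW.
  rewrite -ge0_integralD//; last 4 first.
  - by move=> w _; rewrite lee_fin divr_ge0 ?subr_ge0// ltW.
  - by apply/measurable_EFinP; apply: measurable_funM => //; exact: measurable_funB.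
  - by move=> w _; rewrite -EFinM lee_fin mulr_ge0 ?expR_ge0// invr_ge0 ltW.
  - by apply/measurable_EFinP; exact: measurable_funM.
  rewrite -[RHS](integral_cst_probability P); apply: eq_integral => w _.
  rewrite -EFinM -EFinD; congr EFin; rewrite /cst; field.
  by rewrite gt_eqF.
have -> : \int[P]_w ((1 - e w) / z)%:E = ((1 - l) / z)%:E.
  by rewrite mulrBl mul1r EFinB -J0 addeK.
by rewrite -EFinM; congr EFin; rewrite invfM; ring.
Qed.

End integrated_tail.

(** * The theorem *)

Section claim_summary.
Context {disp : measure_display} {T : measurableType disp} {R : realType}.
Variables (P : probability T R) (d : nat) (M : group_claims_model P d).
Hypothesis d_gt0 : (0 < d)%N.

Local Notation K := (total_rate M * (1 - p0 M)).

Lemma total_rate_p0 :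
  total_rate M * p0 M = \sum_(s < d) pr_eq P (Utilde1 M s) 0%N * rate M s.
Proof.
rewrite /p0 /empty_group_prob mulrCA divff ?mulr1//.
exact/lt0r_neq0/total_rate_gt0.
Qed.

Lemma claim_intensity :
  K = \sum_(s < d) (1 - pr_eq P (Utilde1 M s) 0%N) * rate M s.
Proof.
rewrite mulrBr mulr1 total_rate_p0 -sumrB.
by apply: eq_bigr => s _; rewrite mulrBl mul1r.
Qed.

Lemma claim_iid : iid P (fun i => claim M i : T -> R).
Proof.
split; first exact: claim_independent.
by move=> i j B mB; exact: claim_identically_distributed.
Qed.

Lemma mmt_gen_funE (X : T -> R) (z : R) :
  ('M_P X z = \int[P]_w (expR (z * X w))%:E)%E.
Proof.
rewrite /mmt_gen_fun expectation_integral; apply: eq_integral => w _ /=.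
by rewrite mulrC.
Qed.

Lemma laplaceE (X : T -> R) (z : R) :
  (laplace P X z = \int[P]_w (expR (- z * X w))%:E)%E.
Proof.
rewrite /laplace expectation_integral; apply: eq_integral => w _ /=.
by rewrite mulNr.
Qed.

Lemma mmt_gen_fun_claim (z : R) :
  (forall s, ('M_P (Ytilde11 M s) z < +oo)%E) ->
  (forall s, (pgf P (Utilde1 M s) (fine ('M_P (Ytilde11 M s) z)) < +oo)%E) ->
  'M_P (claim M 0%N) z =
    (\sum_(s < d) rate M s *
       (fine (pgf P (Utilde1 M s) (fine ('M_P (Ytilde11 M s) z))) -
        pr_eq P (Utilde1 M s) 0%N) / K)%:E.
Proof.
move=> Yz Uz.
rewrite mmt_gen_funE (integral_claim_expR (a := fun s => fine ('M_P (Ytilde11 M s) z)))//.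
  congr EFin; rewrite /p0 /empty_group_prob -/(p0 M) mulr_suml -sumrB mulr_suml.
  by apply: eq_bigr => s _; rewrite invfM /total_rate; ring.
move=> s; rewrite -mmt_gen_funE fineK// ge0_fin_numE//.
by rewrite mmt_gen_funE; apply: integral_ge0 => w _; rewrite lee_fin expR_ge0.
Qed.

Lemma laplace_ge0_le1 (X : {RV P >-> R}) (z : R) : 0 < z ->
  {ae P, forall w, 0 < X w} -> (0 <= laplace P X z <= 1)%E.
Proof.
move=> z0 X_gt0; rewrite laplaceE; apply/andP; split.
  by apply: integral_ge0 => w _; rewrite lee_fin expR_ge0.
rewrite -[leRHS](integral_cst_probability P); apply: ae_ge0_le_integral => //.
- apply/measurable_EFinP; apply: measurableT_comp => //.
  exact: measurableT_comp.
- apply: filterS X_gt0 => w X0 _.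
  by rewrite lee_fin -expR0 ler_expR mulNr oppr_le0 mulr_ge0// ltW.
Qed.

Lemma pgf_lty (U : {RV P >-> nat}) (a : R) : 0 <= a <= 1 ->
  (pgf P U a < +oo)%E.
Proof.
move=> /andP[a0 a1]; apply: (@le_lt_trans _ _ 1%E); last exact: ltry.
rewrite /pgf expectation_integral -[leRHS](integral_cst_probability P).
apply: ge0_le_integral => //.
- by move=> w _; rewrite lee_fin exprn_ge0.
- apply/measurable_EFinP.
  by apply: (@measurableT_comp _ _ _ _ _ _ (fun n : nat => a ^+ n)).
- by move=> w _; rewrite lee_fin exprn_ile1.
Qed.

(** For [z > 0] the transform lies in the unit interval, so [fine] loses nothing and the generating
    functions are finite there. *)
Lemma laplace_claim_fin (z : R) s : 0 < z ->
  0 <= fine (laplace P (Ytilde11 M s) z) <= 1 /\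
  laplace P (Ytilde11 M s) z = (fine (laplace P (Ytilde11 M s) z))%:E.
Proof.
move=> z0; have /andP[l0 l1] := laplace_ge0_le1 z0
  (@Ytilde_positive _ _ _ _ _ M 0%N 0%N s : {ae P, forall w, 0 < Ytilde11 M s w}).
have lfin : (laplace P (Ytilde11 M s) z = (fine (laplace P (Ytilde11 M s) z))%:E)%E.
  by rewrite fineK// ge0_fin_numE// (le_lt_trans l1)// ltry.
by split=> //; rewrite -!lee_fin -lfin l0 l1.
Qed.

Lemma laplace_claim (z : R) : 0 < z ->
  laplace P (claim M 0%N) z =
  ((\sum_(s < d) rate M s / total_rate M *
      fine (pgf P (Utilde1 M s) (fine (laplace P (Ytilde11 M s) z))) -
    p0 M) / (1 - p0 M))%:E.
Proof.
move=> z0; rewrite laplaceE.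
apply: integral_claim_expR => s; have [l01 lE] := laplace_claim_fin s z0.
  by rewrite -lE laplaceE.
exact: pgf_lty.
Qed.

Lemma laplace_claim_joint_pgf (z : R) : 0 < z ->
  laplace P (claim M 0%N) z =
  joint_pgf P (fun s => Uvec M 0%N s : T -> nat)
    (fun s => fine (laplace P (Ytilde11 M s) z)).
Proof.
move=> z0; rewrite laplace_claim// joint_pgf_Uvec// => s;
  have [l01 _] := laplace_claim_fin s z0.
  by case/andP: l01.
exact: pgf_lty.
Qed.

Hypothesis EY_fin : forall s, ('E_P[Ytilde11 M s] < +oo)%E.
Hypothesis EU_fin : forall s, ('E_P[natrv (Utilde1 M s)] < +oo)%E.

(** This is the normalizing constant of the integrated tail. Were it 0, the claim would vanish
    almost surely. *)
Lemma claim_mean_gt0 : 0 < \sum_(s < d) rate M s * mean P (natrv (Utilde1 M s)) / K *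
  mean P (Ytilde11 M s).
Proof.
have int := integral_norm_claim EY_fin EU_fin 0%N.
rewrite lt_neqAle -lee_fin -int integral_ge0// andbT; apply/eqP => m0.
rewrite -m0 in int.
have : ae_eq P setT (fun w => (`|claim M 0%N w|)%:E) (cst 0%E).
  apply/ae_eq_integral_abs => //.
    by apply/measurable_EFinP; exact: measurableT_comp.
  by under eq_integral do rewrite gee0_abs//.
have C0 := claim_gt0 M 0%N.
move=> C1; have [N [mN PN0]] : P.-negligible setT.
  apply: negligibleS (negligibleU C0 C1) => w _.
  have [c0|c0] := ltP 0 (claim M 0%N w); [right|left].
    by move=> /= /(_ I) [] /normr0_eq0 c1; have /eqP := lt0r_neq0 c0.
  by move=> /= c1; rewrite ltNge c0 in c1.
rewrite subTset => NT; have := probability_setT P; rewrite -NT.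
by move=> /(etrans (esym PN0))/esym/eqP; rewrite onee_eq0.
Qed.

Lemma integrated_tail_claim : exists F : cumulativeBounded (0 : R) (1 : R),
  (forall x, F x = integrated_tail (claim M 0%N) x) /\
  (forall z : R, 0 < z ->
    lst_cdf F z =
      ((\sum_(s < d) rate M s *
          (1 - fine (pgf P (Utilde1 M s)
                       (fine (laplace P (Ytilde11 M s) z))))) /
       (z * \sum_(s < d) rate M s * mean P (natrv (Utilde1 M s)) *
              mean P (Ytilde11 M s)))%:E).
Proof.
have C0 : {ae P, forall w, 0 <= claim M 0%N w}.
  by apply: filterS (claim_gt0 M 0%N) => w /ltW.
have mE : mean P (claim M 0%N) = \sum_(s < d) rate M s *
    mean P (natrv (Utilde1 M s)) / K * mean P (Ytilde11 M s).
  by rewrite /mean expectation_claim.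
have [F [FE Flst]] := integrated_tail_transform C0 claim_mean_gt0
  (integral_norm_claim EY_fin EU_fin 0%N).
exists F; split=> [x|z z0]; first by rewrite FE /integrated_tail mE.
have := laplace_claim z0; rewrite laplaceE.
under eq_integral do rewrite mulNr.
move=> /(Flst _ _ z0) ->; congr EFin.
have p1 : 1 - p0 M != 0 by rewrite gt_eqF// subr_gt0 p0_lt1.
have t0 : total_rate M != 0 by rewrite gt_eqF// total_rate_gt0.
set g := fun s => fine (pgf P (Utilde1 M s) (fine (laplace P (Ytilde11 M s) z))).
(* The mean is [S / K], and one minus the transform is the total rate less the weighted generating
   functions, over [K]; the factor [K] cancels. *)
pose S := \sum_(s < d) rate M s * mean P (natrv (Utilde1 M s)) * mean P (Ytilde11 M s).
have SE : \sum_(s < d) rate M s * mean P (natrv (Utilde1 M s)) / K *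
    mean P (Ytilde11 M s) = S / K.
  by rewrite [RHS]mulr_suml; apply: eq_bigr => s _; rewrite mulrAC.
have S0 : S != 0.
  have := claim_mean_gt0; rewrite SE => /lt0r_neq0.
  by apply: contra_neq => ->; rewrite mul0r.
rewrite SE -/S.
have -> : \sum_(s < d) rate M s * (1 - g s) = total_rate M - \sum_(s < d) rate M s * g s.
  by rewrite /total_rate -sumrB; apply: eq_bigr => s _; rewrite mulrBr mulr1.
have -> : \sum_(s < d) rate M s / total_rate M * g s =
    (\sum_(s < d) rate M s * g s) / total_rate M.
  by rewrite mulr_suml; apply: eq_bigr => s _; rewrite mulrAC.
by field; rewrite p1 t0 S0 gt_eqF.
Qed.

Lemma claim_cramer_lundberg (u c : R) :
  cramer_lundberg u c K (Ncount M) (claim M) (risk_process M u c).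
Proof.
split.
- exact: Ncount_poisson.
- exact: claim_iid.
- exact: claim_gt0.
- exact: claim_nonlattice.
- by move=> i; rewrite expectation_claim// ltry.
- exact: Ncount_independent_claim.
- by [].
Qed.

End claim_summary.

Theorem theorem5p1 (disp : measure_display) (T : measurableType disp)
  (R : realType) (P : probability T R) (d : nat) (M : group_claims_model P d)
  (u c : R) (d_gt0 : (0 < d)%N) (u_ge0 : 0 <= u) (c_gt0 : 0 < c)
  (EY_fin : forall s, ('E_P[Ytilde11 M s] < +oo)%E)
  (EU_fin : forall s, ('E_P[natrv (Utilde1 M s)] < +oo)%E) :
  (* R is a Cramer-Lundberg risk process *)
  cramer_lundberg u c (total_rate M * (1 - p0 M)) (Ncount M) (claim M)
    (risk_process M u c) /\
  (* (a) *)
  total_rate M * (1 - p0 M) =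
    \sum_(s < d) (1 - pr_eq P (Utilde1 M s) 0%N) * rate M s /\
  (* (b) *)
  (forall i w, claim M i w =
    \sum_(s < d) random_sum (Uvec M i s w) (fun j => Ytilde M i j s w)) /\
  (forall i, {ae P, forall w, 0 < claim M i w}) /\
  iid P (fun i => claim M i : T -> R) /\
  (forall i, ~ lattice P (claim M i)) /\
  'E_P[claim M 0%N]%E =
    (\sum_(s < d) rate M s * mean P (natrv (Utilde1 M s)) /
       (total_rate M * (1 - p0 M)) * mean P (Ytilde11 M s))%:E /\
  (mutually_independent P (fun s => g_sigma_algebra_preimage (Ytilde11 M s)) ->
    (forall z : R,
      (forall s, ('M_P (Ytilde11 M s) z < +oo)%E) ->
      (forall s, (pgf P (Utilde1 M s) (fine ('M_P (Ytilde11 M s) z)) < +oo)%E) ->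
      'M_P (claim M 0%N) z =
        (\sum_(s < d) rate M s *
           (fine (pgf P (Utilde1 M s) (fine ('M_P (Ytilde11 M s) z))) -
            pr_eq P (Utilde1 M s) 0%N) /
           (total_rate M * (1 - p0 M)))%:E) /\
    ((forall s, ('V_P[Ytilde11 M s] < +oo)%E) ->
     (forall s, ('V_P[natrv (Utilde1 M s)] < +oo)%E) ->
     'V_P[claim M 0%N]%E =
       (\sum_(s < d) rate M s *
          (var P (natrv (Utilde1 M s)) * mean P (Ytilde11 M s) ^+ 2 +
           mean P (natrv (Utilde1 M s)) ^+ 2 * mean P (Ytilde11 M s) ^+ 2 +
           mean P (natrv (Utilde1 M s)) * var P (Ytilde11 M s)) /
          (total_rate M * (1 - p0 M)) -
        (\sum_(s < d) rate M s * mean P (natrv (Utilde1 M s)) *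
           mean P (Ytilde11 M s) / (total_rate M * (1 - p0 M))) ^+ 2)%:E /\
     (d = 1%N -> forall s : 'I_d,
       'V_P[claim M 0%N]%E =
         ((var P (natrv (Utilde1 M s)) * mean P (Ytilde11 M s) ^+ 2 +
           mean P (natrv (Utilde1 M s)) * var P (Ytilde11 M s)) / (1 - p0 M) -
          p0 M * mean P (natrv (Utilde1 M s)) ^+ 2 *
            mean P (Ytilde11 M s) ^+ 2 / (1 - p0 M) ^+ 2)%:E))) /\
  (forall x : R, 0 <= x ->
    (cdf (claim M 0%N) x =
      \sum_(s < d)
        \sum_(0 <= j <oo | lower_end P (Utilde1 M s) <= j%:R%:E
                             <= upper_end P (Utilde1 M s))
          conv_pow (Ytilde11 M s) j x *
          (rate M s * pr_eq P (Utilde1 M s) j /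
             (total_rate M * (1 - p0 M)))%:E -
      (p0 M / (1 - p0 M))%:E)%E /\
    (1 - cdf (claim M 0%N) x =
      \sum_(s < d)
        \sum_(0 <= j <oo | lower_end P (Utilde1 M s) <= j%:R%:E
                             <= upper_end P (Utilde1 M s))
          (1 - conv_pow (Ytilde11 M s) j x) *
          (rate M s * pr_eq P (Utilde1 M s) j /
             (total_rate M * (1 - p0 M)))%:E)%E) /\
  (mutually_independent P (fun s => g_sigma_algebra_preimage (Ytilde11 M s)) ->
    (forall z : R, 0 < z ->
      laplace P (claim M 0%N) z =
        joint_pgf P (fun s => Uvec M 0%N s : T -> nat)
          (fun s => fine (laplace P (Ytilde11 M s) z)) /\
      laplace P (claim M 0%N) z =
        ((\sum_(s < d) rate M s / total_rate M *
            fine (pgf P (Utilde1 M s) (fine (laplace P (Ytilde11 M s) z))) -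
          p0 M) / (1 - p0 M))%:E) /\
    (exists F : cumulativeBounded (0 : R) (1 : R),
      (forall x, F x = integrated_tail (claim M 0%N) x) /\
      (forall z : R, 0 < z ->
        lst_cdf F z =
          ((\sum_(s < d) rate M s *
              (1 - fine (pgf P (Utilde1 M s)
                           (fine (laplace P (Ytilde11 M s) z))))) /
           (z * \sum_(s < d) rate M s * mean P (natrv (Utilde1 M s)) *
                  mean P (Ytilde11 M s)))%:E))).
Proof.
split; first exact: claim_cramer_lundberg.
split; first exact: claim_intensity.
split; first by [].
split; first by move=> i; exact: claim_gt0.
split; first exact: claim_iid.
split; first by move=> i; exact: claim_nonlattice.
split; first exact: expectation_claim.
split.
  move=> _; split=> [z|VY_fin VU_fin]; first exact: mmt_gen_fun_claim.
  split=> [|d1 s]; first exact: variance_claim.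
  exact: variance_claim_single_type.
split; first by move=> x x0; split; [exact: cdf_claim|exact: ccdf_claim].
move=> _; split=> [z z0|]; last exact: integrated_tail_claim.
split; first exact: laplace_claim_joint_pgf.
exact: laplace_claim.
Qed.
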